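(* Let $A>0$ and let $c_0:S^1\to\mathbb R^2$ be a non-constant Lipschitz curve parametrized at constant speed, $c_0'(\theta)=\frac{L}{2\pi}e^{i\alpha(\theta)}$ for a.e. $\theta$, where $L$ is the length of $c_0$ and $\alpha:\mathbb R\to\mathbb R$ is a function of locally bounded variation with $\alpha(\theta+2\pi)-\alpha(\theta)\in2\pi\mathbb Z$ (a ''1-BV rectifiable curve''). Then $c_0$ lies in the completion of $B_i(S^1,\mathbb R^2)$ with respect to $\mathrm{dist}^{B_i}_{G^A}$: there is a sequence of smooth immersions $c_n$ such that $(\pi(c_n))$ is a Cauchy sequence for $\mathrm{dist}^{B_i}_{G^A}$ and $d_\infty(c_n,c_0)\to0$.
   Context: $S^1=\mathbb R/2\pi\mathbb Z$, $\mathbb R^2\cong\mathbb C$. $\mathrm{Imm}$ is the space of smooth immersions $S^1\to\mathbb R^2$, $B_i(S^1,\mathbb R^2)=\mathrm{Imm}/\mathrm{Diff}(S^1)$ with projection $\pi$. $\ell(c)=\int_{S^1}|c_\theta|d\theta$, $n_c=ic_\theta/|c_\theta|$, $\kappa_c=\det(c_\theta,c_{\theta\theta})/|c_\theta|^3$. For a smooth path $c:[0,1]\times S^1\to\mathbb R^2$ of immersions, $L^{hor}_{G^A}(c)=\int_0^1(\int_{S^1}(1+A\kappa_{c(t)}^2)\langle c_t,n_{c(t)}\rangle^2|c_\theta|d\theta)^{1/2}dt$; $\mathrm{dist}^{B_i}_{G^A}(C_0,C_1)$ is the infimum of $L^{hor}_{G^A}(c)$ over such paths with $\pi(c(0,\cdot))=C_0,\pi(c(1,\cdot))=C_1$.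 For continuous curves $c,d:S^1\to\mathbb R^2$, the Fréchet distance is $d_\infty(c,d)=\inf_h\|c\circ h-d\|_\infty$ over homeomorphisms $h$ of $S^1$. *)

(* Defs.v *)
From Stdlib Require Import Reals ZArith.
From Coquelicot Require Import Coquelicot.
Open Scope R_scope.

Definition pt := (R * R)%type.
Definition pnorm (v : pt) : R := sqrt (fst v ^ 2 + snd v ^ 2).
Definition pdot (u v : pt) : R := fst u * fst v + snd u * snd v.
Definition pdet (u v : pt) : R := fst u * snd v - snd u * fst v.
Definition pdist (u v : pt) : R := pnorm (fst u - fst v, snd u - snd v).

Definition smooth1 (f : R -> R) : Prop :=
  forall (n : nat) (x : R), ex_derive (Derive_n f n) x.

Definition smooth2 (f : R -> R -> R) : Prop :=
  exists D : nat -> nat -> R -> R -> R,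
    D O O = f /\
    forall (i j : nat) (t th : R),
      is_derive (fun s => D i j s th) t (D (S i) j t th) /\
      is_derive (fun s => D i j t s) th (D i (S j) t th) /\
      continuous (fun p : R * R => D i j (fst p) (snd p)) (t, th).

(** Curves S^1 -> R^2 are 2pi-periodic maps R -> R^2. *)
Definition periodic (c : R -> pt) : Prop := forall th, c (th + 2 * PI) = c th.

Definition dcurve (c : R -> pt) (th : R) : pt :=
  (Derive (fun s => fst (c s)) th, Derive (fun s => snd (c s)) th).

Definition is_imm (c : R -> pt) : Prop :=
  smooth1 (fun s => fst (c s)) /\ smooth1 (fun s => snd (c s)) /\
  periodic c /\ forall th, dcurve c th <> (0, 0).

(** Lifts of elements of Diff(S^1) (orientation preserving or reversing). *)
Definition is_diffS1 (phi : R -> R) : Prop :=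
  smooth1 phi /\ (forall x, Derive phi x <> 0) /\
  ((forall x, phi (x + 2 * PI) = phi x + 2 * PI) \/
   (forall x, phi (x + 2 * PI) = phi x - 2 * PI)).

(** pi(d) = pi(e) in B_i = Imm / Diff(S^1). *)
Definition same_orbit (d e : R -> pt) : Prop :=
  exists phi, is_diffS1 phi /\ forall th, d th = e (phi th).

Definition is_path_imm (c : R -> R -> pt) : Prop :=
  smooth2 (fun t th => fst (c t th)) /\ smooth2 (fun t th => snd (c t th)) /\
  (forall t th, c t (th + 2 * PI) = c t th) /\
  (forall t th, 0 <= t <= 1 -> dcurve (c t) th <> (0, 0)).

Definition c_t (c : R -> R -> pt) (t th : R) : pt :=
  (Derive (fun s => fst (c s th)) t, Derive (fun s => snd (c s th)) t).
Definition c_th (c : R -> R -> pt) (t th : R) : pt := dcurve (c t) th.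
Definition c_thth (c : R -> R -> pt) (t th : R) : pt :=
  (Derive (fun s => fst (c_th c t s)) th, Derive (fun s => snd (c_th c t s)) th).

Definition normal (c : R -> R -> pt) (t th : R) : pt :=
  let v := c_th c t th in (- snd v / pnorm v, fst v / pnorm v).
Definition kappa (c : R -> R -> pt) (t th : R) : R :=
  pdet (c_th c t th) (c_thth c t th) / pnorm (c_th c t th) ^ 3.

Definition hor_length (A : R) (c : R -> R -> pt) : R :=
  RInt (fun t =>
    sqrt (RInt (fun th =>
      (1 + A * kappa c t th ^ 2) * pdot (c_t c t th) (normal c t th) ^ 2
        * pnorm (c_th c t th)) 0 (2 * PI))) 0 1.

(** dist^{B_i}_{G^A}(pi c0, pi c1), valued in Rbar (+oo if no path exists). *)
Definition dist_Bi (A : R) (c0 c1 : R -> pt) : Rbar :=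
  Glb_Rbar (fun r => exists c : R -> R -> pt,
    is_path_imm c /\ same_orbit (c 0) c0 /\ same_orbit (c 1) c1 /\
    r = hor_length A c).

(** Lifts of homeomorphisms of S^1. *)
Definition is_homeoS1 (h : R -> R) : Prop :=
  continuity h /\
  ((forall x y, x < y -> h x < h y) \/ (forall x y, x < y -> h y < h x)) /\
  ((forall x, h (x + 2 * PI) = h x + 2 * PI) \/
   (forall x, h (x + 2 * PI) = h x - 2 * PI)).

Definition sup_dist (c d : R -> pt) : Rbar :=
  Lub_Rbar (fun r => exists th, r = pdist (c th) (d th)).

Definition frechet_dist (c d : R -> pt) : Rbar :=
  Glb_Rbar (fun r => exists h, is_homeoS1 h /\
    Finite r = sup_dist (fun th => c (h th)) d).

Definition partition (a b : R) (n : nat) (t : nat -> R) : Prop :=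
  t O = a /\ t n = b /\ forall i, (i < n)%nat -> t i <= t (S i).

Fixpoint var_sum (f : R -> R) (t : nat -> R) (n : nat) : R :=
  match n with
  | O => 0
  | S k => var_sum f t k + Rabs (f (t (S k)) - f (t k))
  end.

Fixpoint poly_sum (c : R -> pt) (t : nat -> R) (n : nat) : R :=
  match n with
  | O => 0
  | S k => poly_sum c t k + pdist (c (t (S k))) (c (t k))
  end.

Definition curve_length (c : R -> pt) : Rbar :=
  Lub_Rbar (fun r => exists n t, partition 0 (2 * PI) n t /\ r = poly_sum c t n).

Definition locally_BV (f : R -> R) : Prop :=
  forall a b, a <= b -> exists M, forall n t, partition a b n t -> var_sum f t n <= M.

Definition negligible (N : R -> Prop) : Prop :=
  forall eps, 0 < eps -> exists a b : nat -> R,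
    (forall k, a k <= b k) /\
    (forall x, N x -> exists k, a k < x < b k) /\
    (forall n, sum_f_R0 (fun k => b k - a k) n <= eps).

Definition lipschitz (c : R -> pt) : Prop :=
  exists K, forall x y, pdist (c x) (c y) <= K * Rabs (x - y).

(* Main.v *)
Require Import Defs.
From Stdlib Require Import Reals ZArith Lra Lia FunctionalExtensionality.
From Coquelicot Require Import Coquelicot.
Open Scope R_scope.

(** The angle function is replaced by smooth staircases: on each of the [M = M0 * 4 ^ j] cells of
    width [h = 2 pi / M] it passes smoothly from its value at the left node to its value at the
    right node.  The resulting curve is closed by subtracting the mean of its velocity, which is
    [O(h)] because [c0] is closed.  Interpolating the angle between the scales [h] and [h / 4] moves
    the curve by [O(h)], since the two angles are [O(h)] apart in [L^1], while the total variation
    bounds the integral of [kappa ^ 2] by [O(1 / h)].  So the path has length [O(sqrt h)], which is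
    summable over the scales.  Since [c0] is
    non-constant, [L <> 0]: a Lipschitz function with derivative zero almost everywhere is
    constant. *)

(** * Lipschitz functions and total variation *)

(** Bounding the distance of two far scales step by step would require concatenating smooth paths
    and a triangle inequality for [dist_Bi], whose endpoints match only up to reparametrization.
    Instead the one formula [interp] runs through all scales, and the affine time [b + d * t] turns
    it into a single smooth path from scale [m] to scale [n]; the sum over scales becomes an
    integral of 2^(-time).

    At a jump of the angle no continuous approximation is uniformly close. Hence [close_at] measures
    the error on each cell by the variation there. This relation survives convex combinations and
    passage to coarser cells, so every intermediate angle has small mean velocity, and this keeps
    the whole path immersed.

    All integrands are continuous, so Riemann integrals suffice; the null set enters only through an
    increment inequality for Lipschitz functions, proved with a compensator built from a cover. The
    integer in the period condition may vary with the point, so the angle is first replaced by an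
    extension of its restriction to one period with a single integer. *)

Lemma locally_nondecreasing_le (H : R -> R) (a b : R) :
  a <= b ->
  (forall x, a <= x <= b -> exists d, 0 < d /\
     forall y, a <= y <= b -> Rabs (y - x) < d ->
       (x <= y -> H x <= H y) /\ (y <= x -> H y <= H x)) ->
  H a <= H b.
Proof.
  intros Hab Hloc.
  (* The local condition compares [H] with its value at the centre of the neighbourhood; applied at
     the supremum [s], it puts [s] into the set and, if [s < b], also a point beyond [s]. *)
  destruct (completeness (fun x => a <= x <= b /\ H a <= H x)) as [s [Hub Hlub]].
  - exists b; intros x [[_ Hx] _]; exact Hx.
  - exists a; split; [split|]; lra.
  - assert (Has : a <= s) by (apply Hub; repeat split; lra).
    assert (Hsb : s <= b) by (apply Hlub; intros x [[_ Hx] _]; exact Hx).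
    destruct (Hloc s (conj Has Hsb)) as [d [Hd Hs]].
    assert (Hx : exists x, (a <= x <= b /\ H a <= H x) /\ s - d < x).
    { destruct (Classical_Prop.classic
        (exists x, (a <= x <= b /\ H a <= H x) /\ s - d < x)) as [E|E]; [exact E|].
      exfalso. assert (s <= s - d); [|lra].
      apply Hlub. intros x Hx. destruct (Rle_lt_dec x (s - d)); [assumption|].
      exfalso; apply E; exists x; split; assumption. }
    destruct Hx as [x [[Hxab Hax] Hxs]].
    assert (Hxs' : x <= s) by (apply Hub; split; assumption).
    assert (HaS : H a <= H s).
    { apply Rle_trans with (1 := Hax). apply Hs; try assumption.
      apply Rabs_def1; lra. }
    destruct (Rle_lt_or_eq_dec _ _ Hsb) as [Hlt|Heq]; [|rewrite <- Heq; exact HaS].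
    exfalso.
    pose (y := Rmin b (s + d / 2)).
    assert (Hy : s < y /\ y <= b /\ y <= s + d / 2).
    { unfold y; repeat split; [apply Rmin_glb_lt; lra|apply Rmin_l|apply Rmin_r]. }
    assert (y <= s); [|lra].
    apply Hub; split; [lra|]. apply Rle_trans with (1 := HaS).
    apply Hs; try lra. apply Rabs_def1; lra.
Qed.

(* [cover_measure a b x] is the total length of the parts of the intervals [a k, b k] below [x]. *)
Definition cover_measure (a b : nat -> R) (x : R) : R :=
  Series (fun k => Rmin (Rmax x (a k)) (b k) - a k).

Section Cover.

Variables (a b : nat -> R) (eps : R).
Hypothesis Hab : forall k, a k <= b k.
Hypothesis Hsum : forall n, sum_f_R0 (fun k => b k - a k) n <= eps.

Let g (x : R) (k : nat) := Rmin (Rmax x (a k)) (b k) - a k.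

Lemma cover_term_bounds (x : R) (k : nat) : 0 <= g x k <= b k - a k.
Proof.
  specialize (Hab k). unfold g, Rmin, Rmax.
  destruct (Rle_dec x (a k)); destruct (Rle_dec _ (b k)); lra.
Qed.

Lemma ex_cover_length : ex_series (fun k => b k - a k).
Proof.
  assert (H : ex_finite_lim_seq (sum_n (fun k => b k - a k))).
  { apply (ex_finite_lim_seq_incr _ eps); intros n.
    - rewrite sum_Sn. unfold plus; simpl. specialize (Hab (S n)). lra.
    - rewrite sum_n_Reals. apply Hsum. }
  destruct H as [l Hl]. exists l. exact Hl.
Qed.

Lemma ex_cover_series (x : R) : ex_series (g x).
Proof.
  apply (@ex_series_le R_AbsRing R_CompleteNormedModule _ (fun k => b k - a k)).
  - intros k. destruct (cover_term_bounds x k) as [H1 H2].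
    unfold norm; simpl; unfold abs; simpl.
    rewrite Rabs_right; [exact H2|apply Rle_ge, H1].
  - exact ex_cover_length.
Qed.

Lemma Series_ge_0 (u : nat -> R) : ex_series u -> (forall k, 0 <= u k) -> 0 <= Series u.
Proof.
  intros Hu H. rewrite <- (Rmult_0_l (Series u)), <- Series_scal_l.
  apply Series_le; [|exact Hu].
  intros n. specialize (H n). lra.
Qed.

Lemma cover_measure_bounds (x : R) : 0 <= cover_measure a b x <= eps.
Proof.
  split.
  - apply (Series_ge_0 (g x)); [apply ex_cover_series|].
    intros k; apply cover_term_bounds.
  - apply Rle_trans with (Series (fun k => b k - a k)).
    + apply Series_le; [intros k; apply cover_term_bounds|apply ex_cover_length].
    + assert (H := Series_correct _ ex_cover_length).
      apply (is_lim_seq_le (sum_n (fun k => b k - a k)) (fun _ => eps)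
               (Series (fun k => b k - a k)) eps).
      * intros n. rewrite sum_n_Reals. apply Hsum.
      * exact H.
      * apply is_lim_seq_const.
Qed.

Lemma Series_ge_term (u : nat -> R) (k : nat) :
  ex_series u -> (forall i, 0 <= u i) -> u k <= Series u.
Proof.
  revert u; induction k as [|k IH]; intros u Hu H.
  - rewrite (Series_incr_1 u Hu).
    assert (0 <= Series (fun i => u (S i))); [|lra].
    apply Series_ge_0; [apply -> (ex_series_incr_1 u); exact Hu|intros i; apply H].
  - rewrite (Series_incr_1 u Hu).
    assert (Hu' : ex_series (fun i => u (S i))) by (apply -> (ex_series_incr_1 u); exact Hu).
    specialize (IH (fun i => u (S i)) Hu' (fun i => H (S i))). specialize (H O).
    simpl in IH. lra.
Qed.

(** Every term is nondecreasing in the point, so the series of increments dominates each of its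
    terms. Inside the [k]-th interval the measure therefore grows with slope at least one. *)
Lemma cover_measure_increment (x y : R) (k : nat) :
  x <= y -> g y k - g x k <= cover_measure a b y - cover_measure a b x.
Proof.
  intros Hxy.
  assert (Hd : forall i, 0 <= g y i - g x i).
  { intros i. specialize (Hab i). unfold g, Rmin, Rmax.
    destruct (Rle_dec x (a i)); destruct (Rle_dec y (a i));
    repeat destruct (Rle_dec _ (b i)); lra. }
  unfold cover_measure. fold (g x). fold (g y).
  rewrite <- (Series_minus (g y) (g x) (ex_cover_series y) (ex_cover_series x)).
  apply (Series_ge_term (fun i => g y i - g x i) k); [|exact Hd].
  apply (@ex_series_minus R_AbsRing R_NormedModule); apply ex_cover_series.
Qed.

End Cover.

Definition R_lipschitz (f : R -> R) : Prop :=
  exists K, forall x y, Rabs (f x - f y) <= K * Rabs (x - y).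

(** The function [(M + eps) * x + K' * G x - f x] is locally nondecreasing: off [N] by the
    derivative bound, on [N] thanks to the compensator [G], the measure of a cover of [N] of total
    length at most [eps]. The compensator costs at most [K' * eps], which vanishes in the limit. *)
Lemma lipschitz_increment_le (f : R -> R) (N : R -> Prop) (a b M : R) :
  a <= b -> R_lipschitz f -> negligible N ->
  (forall x, a <= x <= b -> ~ N x -> exists l, is_derive f x l /\ l <= M) ->
  f b - f a <= M * (b - a).
Proof.
  intros Hab [K0 HK0] HN Hder.
  pose (K := Rabs K0).
  assert (HK : forall x y, Rabs (f x - f y) <= K * Rabs (x - y)).
  { intros x y. apply Rle_trans with (1 := HK0 x y).
    apply Rmult_le_compat_r; [apply Rabs_pos|apply Rle_abs]. }
  assert (HKp : 0 <= K) by apply Rabs_pos.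
  assert (Hmain : forall eps, 0 < eps ->
            f b - f a <= (M + eps) * (b - a) + (K + Rabs M) * eps).
  { intros eps Heps.
    destruct (HN eps Heps) as [u [v [Huv [Hcov Hsum]]]].
    pose (G := cover_measure u v).
    pose (K' := K + Rabs M).
    assert (HK' : 0 <= K') by (unfold K'; assert (H := Rabs_pos M); lra).
    assert (HG : forall x y k, x <= y -> u k < x < v k -> u k < y < v k ->
                   y - x <= G y - G x).
    { intros x y k Hxy Hx Hy.
      apply Rle_trans with (2 := cover_measure_increment u v eps Huv Hsum x y k Hxy).
      unfold Rmin, Rmax.
      destruct (Rle_dec x (u k)); destruct (Rle_dec y (u k));
      repeat destruct (Rle_dec _ (v k)); lra. }
    assert (HGm : forall x y, x <= y -> 0 <= G y - G x).
    { intros x y Hxy.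
      apply Rle_trans with (2 := cover_measure_increment u v eps Huv Hsum x y 0 Hxy).
      specialize (Huv O). unfold Rmin, Rmax.
      destruct (Rle_dec x (u O)); destruct (Rle_dec y (u O));
      repeat destruct (Rle_dec _ (v O)); lra. }
    assert (H := locally_nondecreasing_le
      (fun x => (M + eps) * x + K' * G x - f x) a b Hab).
    simpl in H. cut (G b - G a <= eps).
    2:{ assert (H1 := cover_measure_bounds u v eps Huv Hsum a).
        assert (H2 := cover_measure_bounds u v eps Huv Hsum b).
        unfold G; lra. }
    intros HGab.
    assert (H' : (M + eps) * a + K' * G a - f a <= (M + eps) * b + K' * G b - f b).
    2:{ fold K'. assert (K' * (G b - G a) <= K' * eps); [|lra].
        apply Rmult_le_compat_l; assumption. }
    apply H; clear H. intros x Hx.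
    destruct (Classical_Prop.classic (N x)) as [HNx|HNx].
    - destruct (Hcov x HNx) as [k Hk].
      exists (Rmin (x - u k) (v k - x)). split; [apply Rmin_glb_lt; lra|].
      (* Here [G] has slope at least one, so [K' = K + Rabs M] absorbs both the Lipschitz growth of
         [f] and a negative slope [M]. *)
      assert (Hinc : forall p q, p <= q -> u k < p < v k -> u k < q < v k ->
        (M + eps) * p + K' * G p - f p <= (M + eps) * q + K' * G q - f q).
      { intros p q Hpq Hp Hq.
        assert (H1 := HG p q k Hpq Hp Hq).
        assert (H2 := HK q p). rewrite (Rabs_right (q - p)) in H2 by lra.
        assert (H3 := Rle_abs (f q - f p)).
        assert (H4 : K' * (q - p) <= K' * (G q - G p))
          by (apply Rmult_le_compat_l; lra).
        assert (H5 : 0 <= (Rabs M + M + eps) * (q - p)).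
        { apply Rmult_le_pos; [|lra]. assert (H5 := Rle_abs (- M)).
          rewrite Rabs_Ropp in H5. lra. }
        unfold K' in *. nra. }
      intros y Hy Hyx.
      assert (Hy1 : u k < y < v k).
      { apply Rabs_def2 in Hyx.
        assert (Hm1 := Rmin_l (x - u k) (v k - x)).
        assert (Hm2 := Rmin_r (x - u k) (v k - x)). lra. }
      split; intros Hle; apply Hinc; assumption.
    - destruct (Hder x Hx HNx) as [l [Hl HlM]].
      apply is_derive_Reals in Hl.
      destruct (Hl eps Heps) as [d Hd].
      exists d. split; [apply cond_pos|]. intros y Hy Hyx.
      destruct (Req_dec y x) as [->|Hne]; [split; lra|].
      assert (Hq := Hd (y - x) (Rminus_eq_contra _ _ Hne) Hyx).
      replace (x + (y - x)) with y in Hq by ring.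
      apply Rabs_def2 in Hq.
      assert (Hf : f y - f x = (f y - f x) / (y - x) * (y - x)) by (field; lra).
      set (q := (f y - f x) / (y - x)) in *.
      split; intros Hle.
      + assert (0 <= (M + eps - q) * (y - x)) by (apply Rmult_le_pos; lra).
        assert (H1 := HGm x y Hle). assert (0 <= K' * (G y - G x)) by (apply Rmult_le_pos; lra).
        nra.
      + assert (0 <= (M + eps - q) * (x - y)) by (apply Rmult_le_pos; lra).
        assert (H1 := HGm y x Hle). assert (0 <= K' * (G x - G y)) by (apply Rmult_le_pos; lra).
        nra. }
  apply le_epsilon. intros e He.
  set (W := b - a + (K + Rabs M) + 1).
  assert (HW : 0 < W) by (unfold W; assert (H := Rabs_pos M); lra).
  assert (Heps : 0 < e / W) by (apply Rdiv_lt_0_compat; assumption).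
  assert (H := Hmain (e / W) Heps).
  assert (HWe : e / W * W = e) by (field; lra).
  apply Rle_trans with (1 := H).
  assert ((b - a + (K + Rabs M)) * (e / W) <= e); [|nra].
  rewrite <- HWe at 2. unfold W at 3. nra.
Qed.

Lemma lipschitz_increment_abs (f : R -> R) (N : R -> Prop) (a b M : R) :
  a <= b -> R_lipschitz f -> negligible N ->
  (forall x, a <= x <= b -> ~ N x -> exists l, is_derive f x l /\ Rabs l <= M) ->
  Rabs (f b - f a) <= M * (b - a).
Proof.
  intros Hab Hf HN Hder. apply Rabs_le.
  assert (H1 : f b - f a <= M * (b - a)).
  { apply (lipschitz_increment_le f N a b M Hab Hf HN). intros x Hx HNx.
    destruct (Hder x Hx HNx) as [l [Hl HlM]]. exists l; split; [exact Hl|].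
    apply Rle_trans with (2 := HlM), Rle_abs. }
  assert (H2 : (fun x => - f x) b - (fun x => - f x) a <= M * (b - a)).
  { apply (lipschitz_increment_le (fun x => - f x) N a b M Hab); [|exact HN|].
    - destruct Hf as [K HK]. exists K. intros x y.
      replace (- f x - - f y) with (- (f x - f y)) by ring. rewrite Rabs_Ropp. apply HK.
    - intros x Hx HNx. destruct (Hder x Hx HNx) as [l [Hl HlM]].
      exists (- l); split; [apply (is_derive_opp f x l Hl)|].
      apply Rle_trans with (2 := HlM). rewrite <- Rabs_Ropp. apply Rle_abs. }
  simpl in H2. lra.
Qed.

(** * Total variation as a monotone majorant of increments *)

Lemma var_sum_ext (f : R -> R) (s t : nat -> R) (n : nat) :
  (forall i, (i <= n)%nat -> s i = t i) -> var_sum f s n = var_sum f t n.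
Proof.
  induction n as [|n IH]; intros H; [reflexivity|].
  simpl. rewrite IH by (intros; apply H; lia). rewrite !H by lia. reflexivity.
Qed.

(** The witness is the total variation on [[0, x]]: a partition of [[0, x]] followed by the point
    [y] is a partition of [[0, y]]. *)
Lemma locally_BV_variation (f : R -> R) :
  locally_BV f ->
  exists V : R -> R, forall x y, 0 <= x -> x <= y -> Rabs (f y - f x) <= V y - V x.
Proof.
  intros Hf.
  pose (E := fun x r => exists n t, partition 0 x n t /\ r = var_sum f t n).
  exists (fun x => real (Lub_Rbar (E x))).
  (* The projection [real] sends infinities to a default value, so finiteness is needed: local
     bounded variation excludes [p_infty], the one-step partition excludes [m_infty]. *)
  assert (HV : forall x, 0 <= x -> is_lub_Rbar (E x) (Finite (real (Lub_Rbar (E x))))).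
  { intros x Hx. destruct (Hf 0 x Hx) as [M HM].
    assert (HE := Lub_Rbar_correct (E x)).
    assert (HEx : E x (Rabs (f x - f 0))).
    { exists 1%nat, (fun i => match i with O => 0 | S _ => x end).
      split; [|simpl; ring].
      repeat split. intros [|i] Hi; [exact Hx|lia]. }
    destruct (Lub_Rbar (E x)) as [l| |].
    - exact HE.
    - destruct HE as [_ HE].
      assert (H : Rbar_le p_infty M).
      { apply HE. intros r [n [t [Ht ->]]]. apply HM. exact Ht. }
      destruct H.
    - destruct HE as [HE _]. destruct (HE _ HEx). }
  intros x y Hx Hxy.
  destruct (HV x Hx) as [_ HVx].
  destruct (HV y (Rle_trans _ _ _ Hx Hxy)) as [HVy _].
  set (Vx := real (Lub_Rbar (E x))) in *. set (Vy := real (Lub_Rbar (E y))) in *.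
  assert (H : Rbar_le Vx (Vy - Rabs (f y - f x))).
  { apply HVx. intros r [n [t [[Ht0 [Htn Ht]] ->]]].
    pose (t' := fun i => if Nat.leb i n then t i else y).
    assert (Hle : forall i, (i <= n)%nat -> t' i = t i).
    { intros i Hi. unfold t'. destruct (Nat.leb_spec i n); [reflexivity|lia]. }
    assert (HS : t' (S n) = y).
    { unfold t'. destruct (Nat.leb_spec (S n) n); [lia|reflexivity]. }
    assert (H := HVy (var_sum f t' (S n))).
    simpl in H |- *. rewrite (var_sum_ext f t' t n Hle), HS, (Hle n), Htn in H by lia.
    enough (var_sum f t n + Rabs (f y - f x) <= Vy) by lra.
    apply H. exists (S n), t'. split.
    - split; [rewrite Hle by lia; exact Ht0|]. split; [exact HS|].
      intros i Hi. destruct (Nat.eq_dec i n) as [->|Hin].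
      + rewrite HS, Hle, Htn by lia. exact Hxy.
      + rewrite !Hle by lia. apply Ht. lia.
    - simpl. rewrite (var_sum_ext f t' t n Hle), HS, (Hle n), Htn by lia. reflexivity. }
  simpl in H. lra.
Qed.

(** * Smooth functions of one variable *)

(** A chain of explicit derivatives instead of [Derive_n]: closure under sums, products and affine
    substitutions becomes an induction on the order. *)
Fixpoint diff1 (n : nat) (f : R -> R) : Prop :=
  match n with
  | O => True
  | S n => exists g, (forall x, is_derive f x (g x)) /\ diff1 n g
  end.

Definition smooth (f : R -> R) : Prop := forall n, diff1 n f.

Lemma diff1_S (n : nat) (f : R -> R) : diff1 (S n) f -> diff1 n f.
Proof.
  revert f; induction n as [|n IH]; intros f; [intros _; exact I|].
  intros [g [Hg Hn]]. exists g; split; [exact Hg|apply IH, Hn].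
Qed.

Lemma smooth_is_derive (f : R -> R) (x : R) : smooth f -> is_derive f x (Derive f x).
Proof.
  intros H. destruct (H 1%nat) as [g [Hg _]].
  rewrite (is_derive_unique f x (g x) (Hg x)). apply Hg.
Qed.

Lemma smooth_Derive (f : R -> R) : smooth f -> smooth (Derive f).
Proof.
  intros H n. destruct (H (S n)) as [g [Hg Hn]].
  replace (Derive f) with g; [exact Hn|].
  extensionality x. symmetry. apply is_derive_unique, Hg.
Qed.

Lemma smooth_intro (f g : R -> R) : (forall x, is_derive f x (g x)) -> smooth g -> smooth f.
Proof.
  intros Hf Hg [|n]; [exact I|]. exists g. split; [exact Hf|apply Hg].
Qed.

Lemma smooth_continuous (f : R -> R) (x : R) : smooth f -> continuous f x.
Proof.
  intros H. apply (ex_derive_continuous f x). eexists. apply (smooth_is_derive f x H).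
Qed.

Lemma smooth_smooth1 (f : R -> R) : smooth f <-> smooth1 f.
Proof.
  split.
  - intros H n. assert (Hn : smooth (Derive_n f n)).
    { induction n as [|n IH]; [exact H|]. simpl. apply smooth_Derive, IH. }
    intros x. eexists. apply smooth_is_derive, Hn.
  - intros H n. revert f H; induction n as [|n IH]; intros f H; [exact I|].
    exists (Derive f). split.
    + intros x. apply Derive_correct, (H O).
    + apply IH. intros k x.
      apply (ex_derive_ext (Derive_n f (S k))); [|apply H].
      intros t. rewrite <- Nat.add_1_r. symmetry. exact (Derive_n_comp f k 1 t).
Qed.

Lemma diff1_const (n : nat) (c : R) : diff1 n (fun _ => c).
Proof.
  revert c; induction n as [|n IH]; intros c; [exact I|].
  exists (fun _ => 0). split; [|apply IH]. intros x. apply (@is_derive_const R_AbsRing).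
Qed.

Lemma diff1_plus (n : nat) (f g : R -> R) :
  diff1 n f -> diff1 n g -> diff1 n (fun x => f x + g x).
Proof.
  revert f g; induction n as [|n IH]; intros f g; [intros; exact I|].
  intros [f' [Hf Hf']] [g' [Hg Hg']]. exists (fun x => f' x + g' x).
  split; [|apply IH; assumption]. intros x. apply (is_derive_plus f g x _ _ (Hf x) (Hg x)).
Qed.

Lemma diff1_mult (n : nat) (f g : R -> R) :
  diff1 n f -> diff1 n g -> diff1 n (fun x => f x * g x).
Proof.
  revert f g; induction n as [|n IH]; intros f g; [intros; exact I|].
  intros Hf0 Hg0. assert (Hf1 := diff1_S n f Hf0). assert (Hg1 := diff1_S n g Hg0).
  destruct Hf0 as [f' [Hf Hf']], Hg0 as [g' [Hg Hg']].
  exists (fun x => f' x * g x + f x * g' x).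
  split; [|apply diff1_plus; apply IH; assumption]. intros x.
  apply (is_derive_mult f g x _ _ (Hf x) (Hg x) Rmult_comm).
Qed.

Lemma smooth_const (c : R) : smooth (fun _ => c).
Proof. intros n; apply diff1_const. Qed.

Lemma smooth_plus (f g : R -> R) : smooth f -> smooth g -> smooth (fun x => f x + g x).
Proof. intros Hf Hg n; apply diff1_plus; auto. Qed.

Lemma smooth_mult (f g : R -> R) : smooth f -> smooth g -> smooth (fun x => f x * g x).
Proof. intros Hf Hg n; apply diff1_mult; auto. Qed.

Lemma smooth_id : smooth (fun x => x).
Proof.
  apply (smooth_intro _ (fun _ => 1)); [intros x; apply (@is_derive_id R_AbsRing)|apply smooth_const].
Qed.

Lemma is_derive_affine (f : R -> R) (p q x l : R) :
  is_derive f (p + q * x) l -> is_derive (fun y => f (p + q * y)) x (q * l).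
Proof.
  intros Hf. apply (is_derive_comp f (fun y => p + q * y) x l q Hf).
  auto_derive; [exact I|ring].
Qed.

Lemma smooth_affine (f : R -> R) (p q : R) : smooth f -> smooth (fun x => f (p + q * x)).
Proof.
  intros Hf n. specialize (Hf n). revert f Hf; induction n as [|n IH]; intros f Hf; [exact I|].
  destruct Hf as [g [Hg Hn]]. exists (fun x => q * g (p + q * x)). split.
  - intros x. apply is_derive_affine, Hg.
  - apply (diff1_mult n (fun _ => q)); [apply diff1_const|apply IH, Hn].
Qed.

(** Iterated derivatives depend only on the germ of the function. This glues the cells of a
    staircase. *)
Lemma smooth_locally (f : R -> R) :
  (forall x : R, exists g, smooth g /\ locally x (fun y => f y = g y)) -> smooth f.
Proof.
  intros H. apply smooth_smooth1. intros n x.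
  destruct (H x) as [g [Hg Hx]]. apply smooth_smooth1 in Hg.
  apply (ex_derive_ext_loc (Derive_n g n)); [|apply Hg].
  apply locally_locally in Hx. revert Hx. apply filter_imp. intros y Hy.
  symmetry. apply Derive_n_ext_loc, Hy.
Qed.

(** * Functions of two variables *)

(** Joint continuity is demanded at every order, so that Schwarz's theorem and differentiation under
    the integral apply to all partial derivatives. *)
Fixpoint diff2 (n : nat) (f : R -> R -> R) : Prop :=
  (forall t x, continuity_2d_pt f t x) /\
  match n with
  | O => True
  | S n => exists g h,
      (forall t x, is_derive (fun s => f s x) t (g t x)) /\
      (forall t x, is_derive (fun y => f t y) x (h t x)) /\
      diff2 n g /\ diff2 n h
  end.

Lemma diff2_continuity (n : nat) (f : R -> R -> R) :
  diff2 n f -> forall t x, continuity_2d_pt f t x.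
Proof. destruct n; intros [H _]; exact H. Qed.

Lemma diff2_S (n : nat) (f : R -> R -> R) : diff2 (S n) f -> diff2 n f.
Proof.
  revert f; induction n as [|n IH]; intros f.
  - intros [H _]; split; [exact H|exact I].
  - intros [H [g [h [Hg [Hh [Hn Hm]]]]]]. split; [exact H|].
    exists g, h. exact (conj Hg (conj Hh (conj (IH g Hn) (IH h Hm)))).
Qed.

Lemma diff2_plus (n : nat) (f1 f2 : R -> R -> R) :
  diff2 n f1 -> diff2 n f2 -> diff2 n (fun t x => f1 t x + f2 t x).
Proof.
  revert f1 f2; induction n as [|n IH]; intros f1 f2 [H1 D1] [H2 D2].
  - split; [|exact I]. intros t x. apply continuity_2d_pt_plus; auto.
  - split; [intros t x; apply continuity_2d_pt_plus; auto|].
    destruct D1 as [g1 [h1 [Hg1 [Hh1 [Gn1 Hn1]]]]], D2 as [g2 [h2 [Hg2 [Hh2 [Gn2 Hn2]]]]].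
    exists (fun t x => g1 t x + g2 t x), (fun t x => h1 t x + h2 t x).
    refine (conj _ (conj _ (conj _ _))); [| |apply IH; assumption|apply IH; assumption]; intros t x.
    + apply (is_derive_plus (fun s => f1 s x) (fun s => f2 s x) t); auto.
    + apply (is_derive_plus (fun y => f1 t y) (fun y => f2 t y) x); auto.
Qed.

Lemma diff2_mult (n : nat) (f1 f2 : R -> R -> R) :
  diff2 n f1 -> diff2 n f2 -> diff2 n (fun t x => f1 t x * f2 t x).
Proof.
  revert f1 f2; induction n as [|n IH]; intros f1 f2 K1 K2.
  - destruct K1 as [H1 _], K2 as [H2 _].
    split; [|exact I]. intros t x. apply continuity_2d_pt_mult; auto.
  - assert (L1 := diff2_S n f1 K1). assert (L2 := diff2_S n f2 K2).
    destruct K1 as [H1 [g1 [h1 [Hg1 [Hh1 [Gn1 Hn1]]]]]].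
    destruct K2 as [H2 [g2 [h2 [Hg2 [Hh2 [Gn2 Hn2]]]]]].
    split; [intros t x; apply continuity_2d_pt_mult; auto|].
    exists (fun t x => g1 t x * f2 t x + f1 t x * g2 t x),
           (fun t x => h1 t x * f2 t x + f1 t x * h2 t x).
    refine (conj _ (conj _ (conj _ _))); [| |apply diff2_plus; apply IH; assumption
                     |apply diff2_plus; apply IH; assumption]; intros t x.
    + apply (is_derive_mult (fun s => f1 s x) (fun s => f2 s x) t _ _ (Hg1 t x) (Hg2 t x)
               Rmult_comm).
    + apply (is_derive_mult (fun y => f1 t y) (fun y => f2 t y) x _ _ (Hh1 t x) (Hh2 t x)
               Rmult_comm).
Qed.

Lemma diff2_fst (n : nat) (u : R -> R) : smooth u -> diff2 n (fun t _ => u t).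
Proof.
  revert u; induction n as [|n IH]; intros u Hu.
  - split; [|exact I]. intros t x.
    apply (continuity_1d_2d_pt_comp u (fun t _ => t)); [|apply continuity_2d_pt_id1].
    apply continuity_pt_filterlim, (smooth_continuous u), Hu.
  - assert (H := IH u Hu). split; [exact (diff2_continuity n _ H)|].
    exists (fun t _ => Derive u t), (fun _ _ => 0). refine (conj _ (conj _ (conj _ _))).
    + intros t x. apply smooth_is_derive, Hu.
    + intros t x. apply (@is_derive_const R_AbsRing).
    + apply IH, smooth_Derive, Hu.
    + apply (IH (fun _ => 0)), smooth_const.
Qed.

Lemma diff2_snd (n : nat) (u : R -> R) : smooth u -> diff2 n (fun _ x => u x).
Proof.
  revert u; induction n as [|n IH]; intros u Hu.
  - split; [|exact I]. intros t x.
    apply (continuity_1d_2d_pt_comp u (fun _ x => x)); [|apply continuity_2d_pt_id2].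
    apply continuity_pt_filterlim, (smooth_continuous u), Hu.
  - assert (H := IH u Hu). split; [exact (diff2_continuity n _ H)|].
    exists (fun _ _ => 0), (fun _ x => Derive u x). refine (conj _ (conj _ (conj _ _))).
    + intros t x. apply (@is_derive_const R_AbsRing).
    + intros t x. apply smooth_is_derive, Hu.
    + apply (IH (fun _ => 0)), smooth_const.
    + apply IH, smooth_Derive, Hu.
Qed.

Lemma diff2_sin_cos (n : nat) (f : R -> R -> R) :
  diff2 n f -> diff2 n (fun t x => sin (f t x)) /\ diff2 n (fun t x => cos (f t x)).
Proof.
  revert f; induction n as [|n IH]; intros f K.
  - destruct K as [H _]. split; (split; [|exact I]); intros t x.
    + apply (continuity_1d_2d_pt_comp sin f); [apply continuity_sin|apply H].
    + apply (continuity_1d_2d_pt_comp cos f); [apply continuity_cos|apply H].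
  - destruct (IH f (diff2_S n f K)) as [Is Ic].
    destruct K as [H [g [h [Hg [Hh [Gn Hn]]]]]].
    split; (split; [intros t x|]).
    + apply (continuity_1d_2d_pt_comp sin f); [apply continuity_sin|apply H].
    + exists (fun t x => g t x * cos (f t x)), (fun t x => h t x * cos (f t x)).
      refine (conj _ (conj _ (conj _ _))); [| |apply diff2_mult; assumption|apply diff2_mult; assumption]; intros t x.
      * apply (is_derive_comp sin (fun s => f s x) t); [|apply Hg]. apply is_derive_sin.
      * apply (is_derive_comp sin (fun s => f t s) x); [|apply Hh]. apply is_derive_sin.
    + apply (continuity_1d_2d_pt_comp cos f); [apply continuity_cos|apply H].
    + exists (fun t x => g t x * ((fun _ _ => -1) t x * sin (f t x))),
             (fun t x => h t x * ((fun _ _ => -1) t x * sin (f t x))).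
      assert (Hm : diff2 n (fun t x => (fun _ _ => -1) t x * sin (f t x))).
      { apply diff2_mult; [apply (diff2_fst n (fun _ => -1)), smooth_const|exact Is]. }
      refine (conj _ (conj _ (conj _ _))); [| |apply diff2_mult; assumption|apply diff2_mult; assumption]; intros t x.
      * replace (g t x * (-1 * sin (f t x))) with (scal (g t x) (- sin (f t x)))
          by (unfold scal; simpl; unfold mult; simpl; ring).
        apply (is_derive_comp cos (fun s => f s x) t); [|apply Hg]. apply is_derive_cos.
      * replace (h t x * (-1 * sin (f t x))) with (scal (h t x) (- sin (f t x)))
          by (unfold scal; simpl; unfold mult; simpl; ring).
        apply (is_derive_comp cos (fun s => f t s) x); [|apply Hh]. apply is_derive_cos.
Qed.

Definition partial1 (f : R -> R -> R) (t x : R) : R := Derive (fun s => f s x) t.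
Definition partial2 (f : R -> R -> R) (t x : R) : R := Derive (fun y => f t y) x.

Definition jointly_smooth (f : R -> R -> R) : Prop := forall n, diff2 n f.

Lemma jointly_smooth_is_derive (f : R -> R -> R) :
  jointly_smooth f ->
  (forall t x, is_derive (fun s => f s x) t (partial1 f t x)) /\
  (forall t x, is_derive (fun y => f t y) x (partial2 f t x)) /\
  jointly_smooth (partial1 f) /\ jointly_smooth (partial2 f).
Proof.
  intros H.
  assert (E : forall n, (forall t x, is_derive (fun s => f s x) t (partial1 f t x)) /\
    (forall t x, is_derive (fun y => f t y) x (partial2 f t x)) /\ diff2 n (partial1 f) /\ diff2 n (partial2 f)).
  { intros n. destruct (H (S n)) as [_ [g [h [Hg [Hh [Hn Hm]]]]]].
    replace (partial1 f) with g.
    2:{ extensionality t; extensionality x; symmetry; apply is_derive_unique, Hg. }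
    replace (partial2 f) with h.
    2:{ extensionality t; extensionality x; symmetry; apply is_derive_unique, Hh. }
    refine (conj _ (conj _ (conj _ _))); assumption. }
  split; [apply (E O)|]. split; [apply (E O)|].
  split; intros n; apply (E n).
Qed.

Lemma jointly_smooth_swap (f : R -> R -> R) : jointly_smooth f -> partial1 (partial2 f) = partial2 (partial1 f).
Proof.
  intros H.
  destruct (jointly_smooth_is_derive f H) as [F1 [F2 [S1 S2]]].
  destruct (jointly_smooth_is_derive _ S1) as [_ [F12 [_ S12]]].
  destruct (jointly_smooth_is_derive _ S2) as [F21 [_ [S21 _]]].
  extensionality t; extensionality x.
  apply (Schwarz f t x).
  - exists (mkposreal 1 Rlt_0_1). intros u v _ _. refine (conj _ (conj _ (conj _ _))).
    + eexists; apply F1.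
    + eexists; apply F2.
    + eexists; apply (F21 u v).
    + eexists; apply (F12 u v).
  - apply (diff2_continuity O _ (S21 O)).
  - apply (diff2_continuity O _ (S12 O)).
Qed.

Lemma iter_jointly_smooth (i j : nat) (f : R -> R -> R) :
  jointly_smooth f -> jointly_smooth (Nat.iter i partial1 (Nat.iter j partial2 f)).
Proof.
  intros H. induction i as [|i IH]; simpl.
  - induction j as [|j IH]; [exact H|]. simpl. apply (jointly_smooth_is_derive _ IH).
  - apply (jointly_smooth_is_derive _ IH).
Qed.

(** The family applies the time derivatives after the space derivatives. A further space derivative
    must then be moved inside past all time derivatives, which is where the partial derivatives have
    to commute. *)
Lemma jointly_smooth_smooth2 (f : R -> R -> R) : jointly_smooth f -> smooth2 f.
Proof.
  intros H. exists (fun i j => Nat.iter i partial1 (Nat.iter j partial2 f)). split; [reflexivity|].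
  intros i j t x. assert (Hij := iter_jointly_smooth i j f H). split; [|split].
  - apply (jointly_smooth_is_derive _ Hij).
  - replace (Nat.iter i partial1 (Nat.iter (S j) partial2 f)) with (partial2 (Nat.iter i partial1 (Nat.iter j partial2 f))).
    + apply (jointly_smooth_is_derive _ Hij).
    + clear Hij. induction i as [|i IH]; [reflexivity|].
      simpl. rewrite <- jointly_smooth_swap by (apply iter_jointly_smooth, H).
      f_equal. exact IH.
  - apply continuity_2d_pt_filterlim, (diff2_continuity O _ (Hij O)).
Qed.

Lemma smooth2_slice (f : R -> R -> R) (t : R) : smooth2 f -> smooth1 (f t).
Proof.
  intros [D [<- HD]] n x.
  assert (E : forall k y, Derive_n (D O O t) k y = D O k t y).
  { induction k as [|k IH]; intros y; [reflexivity|].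
    simpl. rewrite (Derive_ext _ _ y IH). apply is_derive_unique.
    destruct (HD O k t y) as [_ [H _]]. exact H. }
  apply (ex_derive_ext (D O n t)); [intros y; symmetry; apply E|].
  destruct (HD O n t x) as [_ [H _]]. eexists; exact H.
Qed.

(** * Integrals depending on a parameter *)

Lemma ex_RInt_cont (f : R -> R) (a b : R) : (forall x, continuous f x) -> ex_RInt f a b.
Proof. intros H. apply (@ex_RInt_continuous R_CompleteNormedModule). intros; apply H. Qed.

Lemma is_derive_RInt_cont (f : R -> R) (a x : R) :
  (forall x, continuous f x) -> is_derive (RInt f a) x (f x).
Proof.
  intros H. apply (is_derive_RInt f (RInt f a) a x); [|apply H].
  apply filter_forall. intros y. apply (@RInt_correct R_CompleteNormedModule), ex_RInt_cont, H.
Qed.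

Lemma RInt_bound (f : R -> R) (a b M : R) :
  (forall x, continuous f x) -> (forall x, Rmin a b <= x <= Rmax a b -> Rabs (f x) <= M) ->
  Rabs (RInt f a b) <= Rabs (b - a) * M.
Proof.
  intros Hf HM. destruct (Rle_dec a b) as [Hab|Hab].
  - rewrite Rmin_left, Rmax_right in HM by lra. rewrite (Rabs_right (b - a)) by lra.
    apply abs_RInt_le_const; [exact Hab|apply ex_RInt_cont, Hf|exact HM].
  - rewrite Rmin_right, Rmax_left in HM by lra. rewrite (Rabs_left (b - a)) by lra.
    rewrite <- (opp_RInt_swap f b a) by (apply ex_RInt_cont, Hf).
    change (opp (RInt f b a)) with (- RInt f b a). rewrite Rabs_Ropp.
    replace (- (b - a)) with (a - b) by ring.
    apply abs_RInt_le_const; [lra|apply ex_RInt_cont, Hf|exact HM].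
Qed.

Lemma RInt_sub (f : R -> R) (a x y : R) :
  (forall x, continuous f x) -> RInt f a y - RInt f a x = RInt f x y.
Proof.
  intros Hf. rewrite <- (RInt_Chasles f a x y) by (apply ex_RInt_cont, Hf).
  unfold plus; simpl; ring.
Qed.

Definition jointly_continuous (f : R -> R -> R) : Prop := forall t x, continuity_2d_pt f t x.

Lemma jointly_continuous_slice (f : R -> R -> R) (t x : R) :
  jointly_continuous f -> continuous (f t) x.
Proof.
  intros H. apply (filterlim_locally (f t)). intros eps.
  destruct (H t x eps) as [d Hd]. exists d. intros y Hy.
  apply (Hd t y); [|exact Hy].
  rewrite Rminus_diag, Rabs_R0; apply cond_pos.
Qed.

Lemma jointly_continuous_slice1 (f : R -> R -> R) (t x : R) :
  jointly_continuous f -> continuous (fun s => f s x) t.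
Proof.
  intros H. apply (filterlim_locally (fun s => f s x)). intros eps.
  destruct (H t x eps) as [d Hd]. exists d. intros y Hy.
  apply (Hd y x); [exact Hy|].
  rewrite Rminus_diag, Rabs_R0; apply cond_pos.
Qed.

(** The change splits into a change of the parameter on a fixed interval, small by uniform
    continuity, and a short extra interval on which the integrand is bounded. *)
Lemma jointly_continuous_RInt (f : R -> R -> R) :
  jointly_continuous f -> jointly_continuous (fun t x => RInt (f t) 0 x).
Proof.
  intros H t x eps.
  assert (Hc : forall t x, continuous (f t) x) by (intros; apply jointly_continuous_slice, H).
  (* The summand 1 keeps the denominator positive when [x = 0]. *)
  assert (Hp : 0 < eps / (2 * (Rabs x + 1))).
  { apply Rdiv_lt_0_compat; [apply cond_pos|]. assert (Hx := Rabs_pos x); lra. }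
  destruct (uniform_continuity_2d f (t - 1) (t + 1) (Rmin 0 x) (Rmax 0 x)
              (fun u v _ _ => H u v) (mkposreal _ Hp)) as [d1 Hd1].
  destruct (H t x (mkposreal 1 Rlt_0_1)) as [d2 Hd2].
  set (M := Rabs (f t x) + 1).
  assert (HM : 0 < M) by (unfold M; assert (Hx := Rabs_pos (f t x)); lra).
  assert (Hq : 0 < eps / (2 * M)) by (apply Rdiv_lt_0_compat; [apply cond_pos|lra]).
  assert (Hd : 0 < Rmin (Rmin d1 d2) (Rmin 1 (eps / (2 * M)))).
  { repeat apply Rmin_glb_lt; try apply cond_pos; lra. }
  exists (mkposreal _ Hd). simpl. intros u v Hu Hv.
  assert (A1 := Rmin_l (Rmin d1 d2) (Rmin 1 (eps / (2 * M)))).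
  assert (A2 := Rmin_r (Rmin d1 d2) (Rmin 1 (eps / (2 * M)))).
  assert (A3 := Rmin_l d1 d2). assert (A4 := Rmin_r d1 d2).
  assert (A5 := Rmin_l 1 (eps / (2 * M))). assert (A6 := Rmin_r 1 (eps / (2 * M))).
  rewrite <- (RInt_Chasles (f u) 0 x v) by (apply ex_RInt_cont, Hc).
  change (plus (RInt (f u) 0 x) (RInt (f u) x v)) with (RInt (f u) 0 x + RInt (f u) x v).
  replace (RInt (f u) 0 x + RInt (f u) x v - RInt (f t) 0 x)
    with ((RInt (f u) 0 x - RInt (f t) 0 x) + RInt (f u) x v) by ring.
  apply Rle_lt_trans with (1 := Rabs_triang _ _).
  replace (pos eps) with (eps / 2 + eps / 2) by field.
  assert (B2 : Rabs (RInt (f u) x v) < eps / 2).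
  { apply Rle_lt_trans with (Rabs (v - x) * M).
    - apply RInt_bound; [apply Hc|]. intros w Hw.
      assert (Hwx : Rabs (w - x) <= Rabs (v - x)).
      { revert Hw. unfold Rmin, Rmax, Rabs.
        destruct (Rle_dec x v); destruct (Rcase_abs (w - x)); destruct (Rcase_abs (v - x)); lra. }
      assert (Hlt := Hd2 u w). simpl in Hlt.
      assert (Hlt' : Rabs (f u w - f t x) < 1) by (apply Hlt; lra).
      unfold M. replace (f u w) with ((f u w - f t x) + f t x) by ring.
      apply Rle_trans with (1 := Rabs_triang _ _). lra.
    - apply Rlt_le_trans with (eps / (2 * M) * M).
      + apply Rmult_lt_compat_r; lra.
      + apply Req_le. field. lra. }
  assert (B1 : Rabs (RInt (f u) 0 x - RInt (f t) 0 x) <= eps / 2).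
  { change (RInt (f u) 0 x - RInt (f t) 0 x) with (minus (RInt (f u) 0 x) (RInt (f t) 0 x)).
    rewrite <- (RInt_minus (f u) (f t) 0 x) by (apply ex_RInt_cont, Hc).
    apply Rle_trans with (Rabs (x - 0) * (eps / (2 * (Rabs x + 1)))).
    - apply RInt_bound.
      + intros w. apply (@continuous_minus R_UniformSpace R_AbsRing R_NormedModule); apply Hc.
      + intros w Hw. left. assert (A7 := Rabs_def2 _ _ Hu).
        apply (Hd1 t w u w); try lra; try exact Hw.
        rewrite Rminus_diag, Rabs_R0; apply cond_pos.
    - rewrite Rminus_0_r. assert (Hx := Rabs_pos x).
      replace (eps / 2) with ((Rabs x + 1) * (eps / (2 * (Rabs x + 1)))) by (field; lra).
      apply Rmult_le_compat_r; [left; exact Hp|lra]. }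
  lra.
Qed.

Lemma is_derive_RInt_parameter (f g : R -> R -> R) (a b t : R) :
  jointly_continuous f -> jointly_continuous g ->
  (forall t x, is_derive (fun s => f s x) t (g t x)) ->
  is_derive (fun s => RInt (f s) a b) t (RInt (g t) a b).
Proof.
  intros Hf Hg Hfg.
  assert (E : (fun u v => Derive (fun z => f z v) u) = g).
  { extensionality u; extensionality v. apply is_derive_unique, Hfg. }
  replace (RInt (g t) a b) with (RInt (fun x => Derive (fun u => f u x) t) a b).
  2:{ apply RInt_ext. intros x _. apply is_derive_unique, Hfg. }
  apply (is_derive_RInt_param f a b t).
  - apply filter_forall. intros s x _. eexists; apply Hfg.
  - intros x _. rewrite E. apply Hg.
  - apply filter_forall. intros s. apply ex_RInt_cont. intros x.
    apply jointly_continuous_slice, Hf.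
Qed.

(** * Periodic primitives and their dependence on a parameter *)

Definition mean (f : R -> R) : R := RInt f 0 (2 * PI) / (2 * PI).

(* Subtracting the mean makes the primitive of a periodic function periodic. *)
Definition prim (p : R) (f : R -> R) (x : R) : R := p + (RInt f 0 x - x * mean f).

Lemma is_derive_prim (p : R) (f : R -> R) (x : R) :
  (forall x, continuous f x) -> is_derive (prim p f) x (f x - mean f).
Proof.
  intros Hf. unfold prim.
  assert (H := is_derive_RInt_cont f 0 x Hf).
  set (F := RInt f 0) in *. change (is_derive (fun y => p + (F y - y * mean f)) x (f x - mean f)).
  auto_derive; [eexists; exact H|].
  rewrite (is_derive_unique F x _ H : Derive (fun y => F y) x = _). ring.
Qed.

Lemma is_derive_sub_mean (p c t l m : R) (u v : R -> R) :
  is_derive u t l -> is_derive v t m ->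
  is_derive (fun s => p + (u s - c * (v s / (2 * PI)))) t (0 + (l - c * (m / (2 * PI)))).
Proof.
  intros Hu Hv. auto_derive.
  - split; [eexists; exact Hu|]. split; [eexists; exact Hv|exact I].
  - rewrite (is_derive_unique u t _ Hu : Derive (fun s => u s) t = l).
    rewrite (is_derive_unique v t _ Hv : Derive (fun s => v s) t = m).
    unfold Rdiv. ring.
Qed.

Lemma is_derive_prim_parameter (p : R) (f g : R -> R -> R) (t x : R) :
  jointly_continuous f -> jointly_continuous g ->
  (forall t x, is_derive (fun s => f s x) t (g t x)) ->
  is_derive (fun s => prim p (f s) x) t (prim 0 (g t) x).
Proof.
  intros Hf Hg Hfg. unfold prim, mean.
  apply (is_derive_sub_mean p x t _ _ (fun s => RInt (f s) 0 x)
           (fun s => RInt (f s) 0 (2 * PI))); apply is_derive_RInt_parameter; assumption.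
Qed.

Lemma jointly_continuous_mean (f : R -> R -> R) :
  jointly_continuous f -> jointly_continuous (fun t _ => mean (f t)).
Proof.
  intros Hf t x. unfold mean, Rdiv.
  apply continuity_2d_pt_mult; [|apply continuity_2d_pt_const].
  apply (continuity_1d_2d_pt_comp (fun t => RInt (f t) 0 (2 * PI)) (fun t _ => t));
    [|apply continuity_2d_pt_id1].
  apply continuity_pt_filterlim.
  apply (jointly_continuous_slice1 (fun t x => RInt (f t) 0 x)), jointly_continuous_RInt, Hf.
Qed.

Lemma jointly_continuous_prim (p : R) (f : R -> R -> R) :
  jointly_continuous f -> jointly_continuous (fun t x => prim p (f t) x).
Proof.
  intros Hf t x. unfold prim.
  apply continuity_2d_pt_plus; [apply continuity_2d_pt_const|].
  apply continuity_2d_pt_minus; [apply jointly_continuous_RInt, Hf|].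
  apply continuity_2d_pt_mult; [apply continuity_2d_pt_id2|apply jointly_continuous_mean, Hf].
Qed.

(** The partial derivatives are explicit. Order zero in space is again a primitive, whose base point
    disappears after one time derivative; order one subtracts the mean; from order two on the mean,
    constant in space, is gone and the space index drops by one. *)
Lemma smooth2_prim (p : R) (f : R -> R -> R) :
  smooth2 f -> smooth2 (fun t x => prim p (f t) x).
Proof.
  intros [D [<- HD]].
  assert (Hc : forall i j, jointly_continuous (D i j)).
  { intros i j t x. destruct (HD i j t x) as [_ [_ H]]. apply continuity_2d_pt_filterlim, H. }
  assert (H1 : forall i j t x, is_derive (fun s => D i j s x) t (D (S i) j t x)) by apply HD.
  assert (H2 : forall i j t x, is_derive (fun s => D i j t s) x (D i (S j) t x)) by apply HD.
  exists (fun i j t x => match j with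
    | O => prim (match i with O => p | S _ => 0 end) (D i O t) x
    | S O => D i O t x - mean (D i O t)
    | S (S k) => D i (S k) t x
    end).
  split; [reflexivity|]. intros i j t x. split; [|split].
  - destruct j as [|[|j]]; [| |apply H1].
    + apply (is_derive_prim_parameter _ (D i O) (D (S i) O)); auto.
    + unfold mean. assert (G1 := H1 i O t x).
      assert (G2 := is_derive_RInt_parameter _ _ 0 (2 * PI) t (Hc i O) (Hc (S i) O) (H1 i O)).
      assert (G := is_derive_sub_mean 0 1 t _ _ _ _ G1 G2). simpl in G.
      replace (D (S i) O t x - RInt (D (S i) O t) 0 (2 * PI) / (2 * PI))
        with (0 + (D (S i) O t x - 1 * (RInt (D (S i) O t) 0 (2 * PI) / (2 * PI)))) by ring.
      revert G. apply is_derive_ext. intros s. simpl. ring.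
  - destruct j as [|[|j]]; [| |apply H2].
    + apply is_derive_prim. intros y; apply jointly_continuous_slice, Hc.
    + assert (G1 := H2 i O t x). auto_derive; [eexists; exact G1|].
      rewrite (is_derive_unique _ x _ G1 : Derive (fun s => D i O t s) x = _). ring.
  - destruct j as [|[|j]].
    + apply (continuity_2d_pt_filterlim (fun t x => prim (match i with O => p | S _ => 0 end) (D i O t) x)).
      apply jointly_continuous_prim, Hc.
    + apply (continuity_2d_pt_filterlim (fun t x => D i O t x - mean (D i O t))).
      apply continuity_2d_pt_minus; [apply Hc|apply jointly_continuous_mean, Hc].
    + apply (continuity_2d_pt_filterlim (D i (S j))), Hc.
Qed.

(** * A smooth step *)

(** The factor [(/ x) ^ k] makes the family closed under differentiation: the derivative of [flat k]
    combines [flat (S k)] and [flat (S (S k))]. *)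
Definition flat (k : nat) (x : R) : R :=
  if Rle_lt_dec x 0 then 0 else (/ x) ^ k * exp (- / x).

Lemma flat_nonpos (k : nat) (x : R) : x <= 0 -> flat k x = 0.
Proof. intros H. unfold flat. destruct (Rle_lt_dec x 0); [reflexivity|lra]. Qed.

Lemma flat_pos (k : nat) (x : R) : 0 < x -> flat k x = (/ x) ^ k * exp (- / x).
Proof. intros H. unfold flat. destruct (Rle_lt_dec x 0); [lra|reflexivity]. Qed.

(** Half of the exponent is spent on the first [k] powers by induction, the other half on the last
    power, where [exp z >= 1 + z] suffices. *)
Lemma pow_exp_bound (k : nat) : exists C, 0 <= C /\ forall y, 0 < y -> y ^ k * exp (- y) <= C.
Proof.
  induction k as [|k [C [HC IH]]].
  - exists 1. split; [lra|]. intros y Hy. rewrite pow_O, Rmult_1_l, <- exp_0.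
    left. apply exp_increasing. lra.
  - exists (2 ^ S k * C). split; [apply Rmult_le_pos; [apply pow_le; lra|exact HC]|].
    intros y Hy. specialize (IH (y / 2)).
    assert (H1 : y ^ S k * exp (- y)
      = 2 ^ S k * (((y / 2) ^ k * exp (- (y / 2))) * (y / 2 * exp (- (y / 2))))).
    { replace (- y) with (- (y / 2) + - (y / 2)) by field. rewrite exp_plus.
      replace y with (2 * (y / 2)) at 1 by field. rewrite Rpow_mult_distr.
      simpl. ring. }
    rewrite H1. apply Rmult_le_compat_l; [apply pow_le; lra|].
    rewrite <- (Rmult_1_r C). apply Rmult_le_compat.
    + apply Rmult_le_pos; [apply pow_le; lra|left; apply exp_pos].
    + apply Rmult_le_pos; [lra|left; apply exp_pos].
    + apply IH; lra.
    + rewrite exp_Ropp. apply Rmult_le_reg_r with (exp (y / 2)); [apply exp_pos|].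
      assert (E := exp_pos (y / 2)). rewrite Rmult_assoc, Rinv_l, Rmult_1_r by lra.
      assert (H := exp_ineq1_le (y / 2)). lra.
Qed.

Lemma is_derive_flat (k : nat) (x : R) :
  is_derive (flat k) x (- INR k * flat (S k) x + flat (S (S k)) x).
Proof.
  destruct (Rtotal_order x 0) as [Hx|[->|Hx]].
  - rewrite !flat_nonpos by lra. replace (- INR k * 0 + 0) with 0 by ring.
    apply (is_derive_ext_loc (fun _ => 0)); [|apply (@is_derive_const R_AbsRing)].
    assert (Hd : 0 < - x) by lra. exists (mkposreal _ Hd). intros y Hy.
    apply Rabs_def2 in Hy. simpl in Hy. symmetry. apply flat_nonpos.
    unfold minus, plus, opp in Hy; simpl in Hy. lra.
  - rewrite !flat_nonpos by lra. replace (- INR k * 0 + 0) with 0 by ring.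
    apply is_derive_Reals. intros eps Heps.
    destruct (pow_exp_bound (S (S k))) as [C [HC Hb]].
    assert (Hd : 0 < eps / (C + 1)) by (apply Rdiv_lt_0_compat; lra).
    exists (mkposreal _ Hd). simpl. intros h Hh Hhd.
    rewrite Rplus_0_l, (flat_nonpos k 0), !Rminus_0_r by lra.
    destruct (Rle_lt_dec h 0) as [H|H].
    + rewrite flat_nonpos by exact H. unfold Rdiv. rewrite Rmult_0_l, Rabs_R0. exact Heps.
    + rewrite flat_pos by exact H. rewrite Rabs_right in Hhd by lra.
      assert (Hi : 0 < / h) by (apply Rinv_0_lt_compat, H).
      specialize (Hb (/ h) Hi).
      (* One spare power of [h] is split off, so that the difference quotient is at most [C * h] and
         tends to 0. *)
      replace ((/ h) ^ k * exp (- / h) / h) with ((/ h) ^ S (S k) * exp (- / h) * h)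
        by (simpl; field; exact Hh).
      rewrite Rabs_right.
      * apply Rle_lt_trans with (C * h); [apply Rmult_le_compat_r; lra|].
        apply Rle_lt_trans with ((C + 1) * h); [nra|].
        replace eps with ((C + 1) * (eps / (C + 1))) by (field; lra).
        apply Rmult_lt_compat_l; lra.
      * apply Rle_ge, Rmult_le_pos; [|lra].
        apply Rmult_le_pos; [apply pow_le; lra|left; apply exp_pos].
  - rewrite !flat_pos by lra.
    apply (is_derive_ext_loc (fun y => (/ y) ^ k * exp (- / y))).
    + exists (mkposreal _ Hx). intros y Hy.
      apply Rabs_def2 in Hy. simpl in Hy. symmetry. apply flat_pos.
      unfold minus, plus, opp in Hy; simpl in Hy. lra.
    + auto_derive; [lra|]. destruct k as [|k].
      * simpl. field. lra.
      * rewrite Nat.pred_succ. simpl pow. field. lra.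
Qed.

Lemma smooth_flat (k : nat) : smooth (flat k).
Proof.
  intros n. revert k; induction n as [|n IH]; intros k; [exact I|].
  exists (fun x => - INR k * flat (S k) x + flat (S (S k)) x).
  split; [apply is_derive_flat|].
  apply diff1_plus; [|apply IH]. apply (diff1_mult n (fun _ => - INR k)); [apply diff1_const|apply IH].
Qed.

Lemma flat_0_bounds (x : R) : 0 <= flat 0 x <= 1.
Proof.
  unfold flat. destruct (Rle_lt_dec x 0) as [H|H]; [lra|].
  assert (Hi : 0 < / x) by (apply Rinv_0_lt_compat, H).
  assert (Hp := exp_pos (- / x)).
  assert (exp (- / x) < exp 0) by (apply exp_increasing; lra).
  rewrite exp_0 in *. simpl. lra.
Qed.

(** The step is the normalized primitive of a bump supported in [[0, 1]]; since the bump is at most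
    1, its slope is at most [/ Z]. Flatness at both ends lets neighbouring cells glue smoothly and
    later confines the motion in time to one pair of scales. *)
Lemma smooth_step :
  exists (s : R -> R) (S : R),
    smooth s /\ (forall x, x <= 0 -> s x = 0) /\ (forall x, 1 <= x -> s x = 1) /\
    (forall x, 0 <= s x <= 1) /\ (forall x, Rabs (Derive s x) <= S) /\
    (forall x, x <= 0 \/ 1 <= x -> Derive s x = 0).
Proof.
  pose (bump := fun x => flat 0 x * flat 0 (1 + -1 * x)).
  assert (Hbs : smooth bump).
  { apply smooth_mult; [apply smooth_flat|apply smooth_affine, smooth_flat]. }
  assert (Hbc : forall x, continuous bump x) by (intros; apply smooth_continuous, Hbs).
  assert (Hb01 : forall x, 0 <= bump x <= 1).
  { intros x. unfold bump. assert (H1 := flat_0_bounds x).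
    assert (H2 := flat_0_bounds (1 + -1 * x)). nra. }
  assert (Hb0 : forall x, x <= 0 \/ 1 <= x -> bump x = 0).
  { intros x [H|H]; unfold bump.
    - rewrite (flat_nonpos 0 x) by exact H. ring.
    - rewrite (flat_nonpos 0 (1 + -1 * x)) by lra. ring. }
  set (Z := RInt bump 0 1).
  assert (HZ : 0 < Z).
  { apply RInt_gt_0; [lra| |intros; apply Hbc]. intros x Hx. unfold bump.
    rewrite !flat_pos by lra. simpl. assert (H1 := exp_pos (- / x)).
    assert (H2 := exp_pos (- / (1 + -1 * x))). nra. }
  pose (s := fun x => / Z * RInt bump 0 x).
  assert (Hd : forall x, is_derive s x (/ Z * bump x)).
  { intros x. unfold s. apply (is_derive_scal (RInt bump 0) x (/ Z) (bump x)).
    apply is_derive_RInt_cont, Hbc. }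
  assert (HD : forall x, Derive s x = / Z * bump x) by (intros; apply is_derive_unique, Hd).
  assert (HZi : 0 < / Z) by (apply Rinv_0_lt_compat, HZ).
  assert (Hzero : forall a b, a <= b -> (forall x, a < x < b -> bump x = 0) -> RInt bump a b = 0).
  { intros a b Hab H. rewrite (RInt_ext bump (fun _ => 0)).
    - rewrite RInt_const. unfold scal; simpl; unfold mult; simpl; ring.
    - rewrite Rmin_left, Rmax_right by exact Hab. exact H. }
  assert (Hs0 : forall x, x <= 0 -> s x = 0).
  { intros x Hx. unfold s. rewrite <- (opp_RInt_swap bump x 0) by (apply ex_RInt_cont, Hbc).
    rewrite Hzero; [unfold opp; simpl; ring|exact Hx|]. intros y Hy; apply Hb0; lra. }
  assert (Hs1 : forall x, 1 <= x -> s x = 1).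
  { intros x Hx. unfold s. rewrite <- (RInt_Chasles bump 0 1 x) by (apply ex_RInt_cont, Hbc).
    rewrite (Hzero 1 x Hx) by (intros y Hy; apply Hb0; lra).
    fold Z. unfold plus; simpl. field. lra. }
  assert (Hmono : forall x y, x <= y -> s x <= s y).
  { intros x y Hxy. unfold s. apply Rmult_le_compat_l; [lra|].
    assert (0 <= RInt bump x y).
    { apply RInt_ge_0; [exact Hxy|apply ex_RInt_cont, Hbc|intros; apply Hb01]. }
    rewrite <- (RInt_sub bump 0 x y Hbc) in H. lra. }
  exists s, (/ Z). split; [|split; [exact Hs0|split; [exact Hs1|split; [|split]]]].
  - apply (smooth_intro s (fun x => / Z * bump x)); [exact Hd|].
    apply (smooth_mult (fun _ => / Z)); [apply smooth_const|exact Hbs].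
  - intros x. split.
    + destruct (Rle_dec x 0) as [H|H]; [rewrite Hs0 by exact H; lra|].
      rewrite <- (Hs0 0 (Rle_refl 0)). apply Hmono; lra.
    + destruct (Rle_dec 1 x) as [H|H]; [rewrite Hs1 by exact H; lra|].
      rewrite <- (Hs1 1 (Rle_refl 1)). apply Hmono; lra.
  - intros x. rewrite HD. assert (H := Hb01 x). rewrite Rabs_right by (apply Rle_ge; nra). nra.
  - intros x Hx. rewrite HD, Hb0 by exact Hx. ring.
Qed.

(** * Staircase approximations of the angle function *)

Definition staircase (s alpha : R -> R) (h x : R) : R :=
  let q := IZR (Int_part (x / h)) in
  alpha (q * h) + (alpha ((q + 1) * h) - alpha (q * h)) * s (x / h - q).

Lemma Int_part_eq (x : R) (z : Z) : IZR z <= x < IZR z + 1 -> Int_part x = z.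
Proof. intros H. symmetry. apply Int_part_spec. lra. Qed.

Lemma Int_part_spec_IZR (x : R) : IZR (Int_part x) <= x < IZR (Int_part x) + 1.
Proof. destruct (base_Int_part x). lra. Qed.

Lemma Int_part_plus_IZR (x : R) (z : Z) : Int_part (x + IZR z) = (Int_part x + z)%Z.
Proof.
  apply Int_part_eq. rewrite plus_IZR. assert (H := Int_part_spec_IZR x). lra.
Qed.

Section Staircase.

Variables (s alpha : R -> R) (h : R).
Hypothesis Hs : smooth s.
Hypothesis Hs0 : forall x, x <= 0 -> s x = 0.
Hypothesis Hs1 : forall x, 1 <= x -> s x = 1.
Hypothesis Hh : 0 < h.

Lemma staircase_cell (z : Z) (x : R) :
  IZR z * h <= x <= (IZR z + 1) * h ->
  staircase s alpha h x
  = alpha (IZR z * h) + (alpha ((IZR z + 1) * h) - alpha (IZR z * h)) * s (x / h - IZR z).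
Proof.
  intros [H1 H2].
  assert (Hx : x = x / h * h) by (field; lra).
  assert (H3 : IZR z <= x / h) by (apply Rmult_le_reg_r with h; lra).
  destruct (Rle_lt_or_eq_dec _ _ H2) as [H|H].
  - assert (H4 : x / h < IZR z + 1) by (apply Rmult_lt_reg_r with h; lra).
    unfold staircase. rewrite (Int_part_eq (x / h) z) by lra. reflexivity.
  (* At the right node the integer part already belongs to the next cell; both formulas give [alpha]
     at that node. *)
  - assert (H4 : x / h = IZR z + 1) by (rewrite H; field; lra).
    unfold staircase. rewrite (Int_part_eq (x / h) (z + 1)) by (rewrite plus_IZR; lra).
    rewrite plus_IZR, H4. rewrite (Hs0 (IZR z + 1 - (IZR z + 1))) by lra.
    rewrite (Hs1 (IZR z + 1 - IZR z)) by lra. ring.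
Qed.

Lemma is_derive_step_scaled (p q x z : R) :
  is_derive (fun y => p + q * s (y / h - z)) x (q / h * Derive s (x / h - z)).
Proof.
  assert (H := is_derive_affine s (- z) (/ h) x _ (smooth_is_derive s (- z + / h * x) Hs)).
  assert (H' := is_derive_plus _ _ x _ _ (@is_derive_const R_AbsRing R_NormedModule p x)
                 (is_derive_scal _ x q _ H)).
  replace (q / h * Derive s (x / h - z))
    with (plus (zero : R) (q * (/ h * Derive s (- z + / h * x)))).
  - revert H'. apply is_derive_ext. intros y. unfold plus; simpl.
    replace (- z + / h * y) with (y / h - z) by (unfold Rdiv; ring). reflexivity.
  - unfold plus, zero; simpl.
    replace (- z + / h * x) with (x / h - z) by (unfold Rdiv; ring). unfold Rdiv. ring.
Qed.

Lemma smooth_step_scaled (q z : R) : smooth (fun y => q * s (y / h - z)).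
Proof.
  apply (smooth_mult (fun _ => q)); [apply smooth_const|].
  assert (H := smooth_affine s (- z) (/ h) Hs).
  replace (fun y => s (y / h - z)) with (fun y => s (- z + / h * y)); [exact H|].
  extensionality y. f_equal. unfold Rdiv. ring.
Qed.

(** A neighbourhood of [x0] may reach into the cell on the left. The sum of two scaled steps
    describes both cells at once, because the left step has saturated on the right cell and the
    right step has not started on the left one. *)
Lemma staircase_smooth : smooth (staircase s alpha h).
Proof.
  apply smooth_locally. intros x0.
  assert (Hdiv : forall y, y = y / h * h) by (intros; field; lra).
  set (z := Int_part (x0 / h)).
  assert (Hz := Int_part_spec_IZR (x0 / h)). fold z in Hz.
  exists (fun x => alpha ((IZR z - 1) * h)
    + ((alpha (IZR z * h) - alpha ((IZR z - 1) * h)) * s (x / h - (IZR z - 1))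
    + (alpha ((IZR z + 1) * h) - alpha (IZR z * h)) * s (x / h - IZR z))).
  split.
  - apply (smooth_plus (fun _ => _)); [apply smooth_const|].
    apply smooth_plus; apply smooth_step_scaled.
  - assert (Hx0 := Hdiv x0).
    assert (Hlo : (IZR z - 1) * h < x0) by (rewrite Hx0; apply Rmult_lt_compat_r; lra).
    assert (Hhi : x0 < (IZR z + 1) * h) by (rewrite Hx0; apply Rmult_lt_compat_r; lra).
    assert (Hd : 0 < Rmin (x0 - (IZR z - 1) * h) ((IZR z + 1) * h - x0))
      by (apply Rmin_glb_lt; lra).
    exists (mkposreal _ Hd). intros y Hy. simpl in Hy.
    apply Rabs_def2 in Hy. unfold minus, plus, opp in Hy; simpl in Hy.
    assert (M1 := Rmin_l (x0 - (IZR z - 1) * h) ((IZR z + 1) * h - x0)).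
    assert (M2 := Rmin_r (x0 - (IZR z - 1) * h) ((IZR z + 1) * h - x0)).
    assert (Hy' := Hdiv y).
    destruct (Rle_dec (IZR z * h) y) as [H|H].
    + rewrite (staircase_cell z) by lra.
      assert (IZR z <= y / h) by (apply Rmult_le_reg_r with h; lra).
      rewrite (Hs1 (y / h - (IZR z - 1))) by lra. ring.
    + rewrite (staircase_cell (z - 1)) by (rewrite minus_IZR; split; nra).
      rewrite minus_IZR. replace (IZR z - 1 + 1) with (IZR z) by ring.
      assert (y / h <= IZR z) by (apply Rmult_le_reg_r with h; lra).
      rewrite (Hs0 (y / h - IZR z)) by lra. ring.
Qed.

Lemma Derive_staircase (z : Z) (x : R) :
  IZR z * h < x < (IZR z + 1) * h ->
  Derive (staircase s alpha h) x
  = (alpha ((IZR z + 1) * h) - alpha (IZR z * h)) / h * Derive s (x / h - IZR z).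
Proof.
  intros Hx. apply is_derive_unique.
  apply (is_derive_ext_loc (fun y => alpha (IZR z * h)
           + (alpha ((IZR z + 1) * h) - alpha (IZR z * h)) * s (y / h - IZR z)));
    [|apply is_derive_step_scaled].
  assert (Hd : 0 < Rmin (x - IZR z * h) ((IZR z + 1) * h - x)) by (apply Rmin_glb_lt; lra).
  exists (mkposreal _ Hd). intros y Hy. simpl in Hy.
  apply Rabs_def2 in Hy. unfold minus, plus, opp in Hy; simpl in Hy.
  assert (M1 := Rmin_l (x - IZR z * h) ((IZR z + 1) * h - x)).
  assert (M2 := Rmin_r (x - IZR z * h) ((IZR z + 1) * h - x)).
  symmetry. apply staircase_cell. lra.
Qed.

End Staircase.

(** * Angles with a constant increment per period *)

Lemma two_PI_pos : 0 < 2 * PI.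
Proof. assert (H := PI_RGT_0). lra. Qed.

Lemma staircase_period (s alpha : R -> R) (M : nat) (T x : R) :
  (0 < M)%nat -> (forall x, alpha (x + 2 * PI) = alpha x + T) ->
  staircase s alpha (2 * PI / INR M) (x + 2 * PI) = staircase s alpha (2 * PI / INR M) x + T.
Proof.
  intros HM HT. assert (Hp := two_PI_pos). apply lt_0_INR in HM.
  unfold staircase. set (h := 2 * PI / INR M).
  replace ((x + 2 * PI) / h) with (x / h + IZR (Z.of_nat M))
    by (rewrite <- INR_IZR_INZ; unfold h; field; lra).
  rewrite Int_part_plus_IZR, plus_IZR, <- INR_IZR_INZ.
  set (q := IZR (Int_part (x / h))).
  replace ((q + INR M) * h) with (q * h + 2 * PI) by (unfold h; field; lra).
  replace ((q + INR M + 1) * h) with ((q + 1) * h + 2 * PI) by (unfold h; field; lra).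
  replace (x / h + INR M - (q + INR M)) with (x / h - q) by ring.
  rewrite !HT. ring.
Qed.

(** Only one period of [alpha] is kept, so that the increment over a period is the same number [T]
    everywhere. *)
Definition extend (alpha : R -> R) (T x : R) : R :=
  let q := IZR (Int_part (x / (2 * PI))) in alpha (x - q * (2 * PI)) + q * T.

Lemma extend_period (alpha : R -> R) (T x : R) :
  extend alpha T (x + 2 * PI) = extend alpha T x + T.
Proof.
  assert (Hp := two_PI_pos). unfold extend.
  replace ((x + 2 * PI) / (2 * PI)) with (x / (2 * PI) + 1) by (field; lra).
  rewrite (Int_part_plus_IZR _ 1), plus_IZR.
  set (q := IZR (Int_part (x / (2 * PI)))).
  replace (x + 2 * PI - (q + 1) * (2 * PI)) with (x - q * (2 * PI)) by ring. ring.
Qed.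

(** Agreement includes the right end: there the integer part is 1 and the increment turns [alpha 0]
    into [alpha (2 * PI)]. *)
Lemma extend_eq (alpha : R -> R) (x : R) :
  0 <= x <= 2 * PI -> extend alpha (alpha (2 * PI) - alpha 0) x = alpha x.
Proof.
  intros [H0 H1]. assert (Hp := two_PI_pos). unfold extend.
  destruct (Rle_lt_or_eq_dec _ _ H1) as [H| ->].
  - rewrite (Int_part_eq _ 0).
    + replace (x - 0 * (2 * PI)) with x by ring. ring.
    + split; [apply Rdiv_le_0_compat; lra|].
      apply Rmult_lt_reg_r with (2 * PI); [lra|]. field_simplify; lra.
  - rewrite (Int_part_eq _ 1).
    + replace (2 * PI - 1 * (2 * PI)) with 0 by ring. ring.
    + replace (2 * PI / (2 * PI)) with 1 by (field; lra). lra.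
Qed.

(** Each cell contributes at most [C * h] times the increment of [V], and these increments
    telescope. Only this sum is small as [h] tends to 0; a single cell may carry all of the
    variation. *)
Lemma cell_sum (F V : R -> R) (M : nat) (C : R) :
  (0 < M)%nat -> 0 <= C ->
  (forall x y, 0 <= x -> x <= y -> y <= 2 * PI -> V x <= V y) ->
  let h := 2 * PI / INR M in
  (forall k x y, (k < M)%nat -> INR k * h <= x -> x <= y -> y <= (INR k + 1) * h ->
     Rabs (F y - F x) <= C * (V ((INR k + 1) * h) - V (INR k * h)) * (y - x)) ->
  forall y, 0 <= y <= 2 * PI -> Rabs (F y - F 0) <= C * h * (V (2 * PI) - V 0).
Proof.
  intros HM HC HV h Hcell. assert (Hp := two_PI_pos).
  assert (HM' := lt_0_INR M HM).
  assert (Hh : 0 < h) by (apply Rdiv_lt_0_compat; lra).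
  assert (HMh : INR M * h = 2 * PI) by (unfold h; field; lra).
  assert (HCh : 0 <= C * h) by (apply Rmult_le_pos; lra).
  assert (Hk : forall k, (k <= M)%nat -> forall y, 0 <= y <= INR k * h ->
            Rabs (F y - F 0) <= C * h * (V (INR k * h) - V 0)).
  { induction k as [|k IH]; intros HkM y Hy.
    - simpl in Hy. replace y with 0 by lra. simpl. rewrite Rmult_0_l, Rminus_diag, Rabs_R0. lra.
    - rewrite S_INR in *. assert (Hk0 := pos_INR k).
      assert (HkM' : (INR k + 1) * h <= 2 * PI).
      { rewrite <- HMh, <- S_INR. apply Rmult_le_compat_r; [lra|]. apply le_INR; lia. }
      assert (0 <= INR k * h) by (apply Rmult_le_pos; lra).
      assert (HVk : V (INR k * h) <= V ((INR k + 1) * h)) by (apply HV; nra).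
      destruct (Rle_dec y (INR k * h)) as [H1|H1].
      + apply Rle_trans with (1 := IH ltac:(lia) y ltac:(lra)).
        apply Rmult_le_compat_l; lra.
      + assert (I1 := IH ltac:(lia) (INR k * h) ltac:(lra)).
        assert (I2 := Hcell k (INR k * h) y ltac:(lia) ltac:(lra) ltac:(lra) ltac:(lra)).
        replace (F y - F 0) with ((F y - F (INR k * h)) + (F (INR k * h) - F 0)) by ring.
        apply Rle_trans with (1 := Rabs_triang _ _).
        assert (C * (V ((INR k + 1) * h) - V (INR k * h)) * (y - INR k * h)
                <= C * (V ((INR k + 1) * h) - V (INR k * h)) * h).
        { apply Rmult_le_compat_l; [apply Rmult_le_pos; lra|lra]. }
        lra. }
  intros y Hy. rewrite <- HMh at 1. apply (Hk M (le_n M)). rewrite HMh. exact Hy.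
Qed.

(** * Cellwise closeness to the angle function *)

Lemma cell_bounds (M k : nat) :
  (k < M)%nat -> 0 <= INR k * (2 * PI / INR M) /\
    INR k * (2 * PI / INR M) <= (INR k + 1) * (2 * PI / INR M) /\
    (INR k + 1) * (2 * PI / INR M) <= 2 * PI.
Proof.
  intros HkM. assert (Hp := two_PI_pos). assert (HM' : 0 < INR M) by (apply lt_0_INR; lia).
  assert (Hh : 0 < 2 * PI / INR M) by (apply Rdiv_lt_0_compat; lra).
  assert (Hk0 := pos_INR k).
  split; [apply Rmult_le_pos; lra|]. split; [apply Rmult_le_compat_r; lra|].
  replace (2 * PI) with (INR M * (2 * PI / INR M)) at 2 by (field; lra).
  apply Rmult_le_compat_r; [lra|]. rewrite <- S_INR. apply le_INR; lia.
Qed.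

Definition close_at (alpha V : R -> R) (M : nat) (g : R -> R) : Prop :=
  forall k x, (k < M)%nat -> let h := 2 * PI / INR M in
    INR k * h <= x <= (INR k + 1) * h ->
    Rabs (g x - alpha x) <= V ((INR k + 1) * h) - V (INR k * h).

Definition variation_bound (alpha V : R -> R) : Prop :=
  forall x y, 0 <= x -> x <= y -> y <= 2 * PI -> Rabs (alpha y - alpha x) <= V y - V x.

Lemma variation_bound_mono (alpha V : R -> R) (x y : R) :
  variation_bound alpha V -> 0 <= x -> x <= y -> y <= 2 * PI -> V x <= V y.
Proof.
  intros H H0 H1 H2. assert (A := H x y H0 H1 H2). assert (B := Rabs_pos (alpha y - alpha x)). lra.
Qed.

Lemma convex_dist (p q z l d : R) :
  0 <= l <= 1 -> Rabs (p - z) <= d -> Rabs (q - z) <= d -> Rabs (p + (q - p) * l - z) <= d.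
Proof.
  intros Hl Hp Hq. apply Rabs_le_between in Hp. apply Rabs_le_between in Hq.
  apply Rabs_le. split; nra.
Qed.

Lemma close_at_convex (alpha V g1 g2 : R -> R) (M : nat) (l : R) :
  0 <= l <= 1 -> close_at alpha V M g1 -> close_at alpha V M g2 ->
  close_at alpha V M (fun x => g1 x + (g2 x - g1 x) * l).
Proof.
  intros Hl H1 H2 k x Hk h Hx. apply convex_dist; [exact Hl| |]; auto.
Qed.

(** On a cell the staircase is a convex combination of the values of [alpha] at the two nodes, and
    both differ from [alpha x] by at most the variation over the cell. *)
Lemma close_at_staircase (s alpha V : R -> R) (M : nat) :
  variation_bound alpha V ->
  (forall x, x <= 0 -> s x = 0) -> (forall x, 1 <= x -> s x = 1) -> (forall x, 0 <= s x <= 1) ->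
  close_at alpha V M (staircase s alpha (2 * PI / INR M)).
Proof.
  intros HV Hs0 Hs1 Hs k x Hk h Hx. assert (Hp := two_PI_pos).
  destruct (cell_bounds M k Hk) as [B1 [B2 B3]]. fold h in B1, B2, B3 |- *.
  assert (Hh : 0 < h) by (apply Rdiv_lt_0_compat; [lra|apply lt_0_INR; lia]).
  rewrite INR_IZR_INZ in *.
  rewrite (staircase_cell s alpha h Hs0 Hs1 Hh (Z.of_nat k)) by exact Hx.
  assert (A1 := HV _ x B1 (proj1 Hx) ltac:(lra)).
  assert (A2 := HV x _ ltac:(lra) (proj2 Hx) B3).
  assert (A3 := Rabs_pos (alpha x - alpha (IZR (Z.of_nat k) * h))).
  assert (A4 := Rabs_pos (alpha ((IZR (Z.of_nat k) + 1) * h) - alpha x)).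
  apply convex_dist; [apply Hs| |].
  - rewrite Rabs_minus_sym. lra.
  - lra.
Qed.

(** Each of the four fine cells lies in the coarse one, and [V] is monotone. *)
Lemma close_at_coarsen (alpha V g : R -> R) (M : nat) :
  variation_bound alpha V -> close_at alpha V (4 * M) g -> close_at alpha V M g.
Proof.
  intros HV Hg k x Hk h Hx. assert (Hp := two_PI_pos).
  destruct (cell_bounds M k Hk) as [B1 [B2 B3]]. fold h in B1, B2, B3.
  assert (HM' : 0 < INR M) by (apply lt_0_INR; lia).
  pose (h' := 2 * PI / INR (4 * M)).
  assert (Hhh' : h = 4 * h').
  { unfold h, h'. rewrite mult_INR. replace (INR 4) with 4 by (simpl; ring). field; lra. }
  assert (Hh' : 0 < h').
  { apply Rdiv_lt_0_compat; [lra|apply lt_0_INR; lia]. }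
  assert (Hsub : forall i, (i < 4)%nat ->
    (INR k * 4 + INR i) * h' <= x <= (INR k * 4 + INR i + 1) * h' ->
    Rabs (g x - alpha x) <= V ((INR k + 1) * h) - V (INR k * h)).
  { intros i Hi Hix.
    assert (Hki : INR (4 * k + i) = INR k * 4 + INR i).
    { rewrite plus_INR, mult_INR. simpl. ring. }
    assert (Hik : (4 * k + i < 4 * M)%nat) by lia.
    assert (A := Hg (4 * k + i)%nat x Hik). cbv zeta in A. fold h' in A. rewrite Hki in A.
    specialize (A Hix). apply Rle_trans with (1 := A).
    assert (Hi0 := pos_INR i).
    assert (Hi3 : INR i <= 3).
    { replace 3 with (INR 3) by (simpl; ring). apply le_INR; lia. }
    assert (Hk0 := pos_INR k).
    assert (V ((INR k * 4 + INR i + 1) * h') <= V ((INR k + 1) * h)).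
    { apply (variation_bound_mono alpha V); [exact HV| | |exact B3]; rewrite ?Hhh'; nra. }
    assert (V (INR k * h) <= V ((INR k * 4 + INR i) * h')).
    { apply (variation_bound_mono alpha V); [exact HV|exact B1| |]; rewrite ?Hhh' in *; nra. }
    lra. }
  rewrite Hhh' in Hx.
  destruct (Rle_dec x ((INR k * 4 + 1) * h')) as [H1|H1].
  { apply (Hsub 0%nat); [lia|]. simpl. lra. }
  destruct (Rle_dec x ((INR k * 4 + 2) * h')) as [H2|H2].
  { apply (Hsub 1%nat); [lia|]. simpl. lra. }
  destruct (Rle_dec x ((INR k * 4 + 3) * h')) as [H3|H3].
  { apply (Hsub 2%nat); [lia|]. simpl. lra. }
  apply (Hsub 3%nat); [lia|]. simpl. lra.
Qed.

Lemma RInt_le_const_open (f : R -> R) (a b M : R) :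
  a <= b -> (forall x, continuous f x) -> (forall x, a < x < b -> f x <= M) ->
  RInt f a b <= M * (b - a).
Proof.
  intros Hab Hf HM. replace (M * (b - a)) with (RInt (fun _ => M) a b).
  - apply RInt_le; [exact Hab|apply ex_RInt_cont, Hf| |exact HM].
    apply (@ex_RInt_const R_NormedModule).
  - rewrite RInt_const. unfold scal; simpl; unfold mult; simpl. ring.
Qed.

(** The pointwise bound is asked only inside the cells, where the derivative of a staircase has its
    explicit form. *)
Lemma RInt_cells_le (f V : R -> R) (M : nat) (C : R) :
  (0 < M)%nat -> 0 <= C -> (forall x, continuous f x) -> (forall x, 0 <= f x) ->
  (forall x y, 0 <= x -> x <= y -> y <= 2 * PI -> V x <= V y) ->
  let h := 2 * PI / INR M in
  (forall k x, (k < M)%nat -> INR k * h < x < (INR k + 1) * h ->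
     f x <= C * (V ((INR k + 1) * h) - V (INR k * h))) ->
  RInt f 0 (2 * PI) <= C * h * (V (2 * PI) - V 0).
Proof.
  intros HM HC Hf Hf0 HV h Hcell. assert (Hp := two_PI_pos).
  assert (A := cell_sum (RInt f 0) V M C HM HC HV). fold h in A. simpl in A.
  assert (B : Rabs (RInt f 0 (2 * PI) - RInt f 0 0) <= C * h * (V (2 * PI) - V 0)).
  { apply A; [|lra]. intros k x y Hk Hx Hxy Hy.
    rewrite (RInt_sub f 0 x y Hf), Rabs_right.
    - apply RInt_le_const_open; [exact Hxy|exact Hf|]. intros z Hz. apply Hcell; [exact Hk|lra].
    - apply Rle_ge, RInt_ge_0; [exact Hxy|apply ex_RInt_cont, Hf|auto]. }
  rewrite RInt_point in B. apply Rle_trans with (2 := B).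
  unfold zero; simpl. rewrite Rminus_0_r. apply Rle_abs.
Qed.

Lemma continuous_Rabs_comp (f : R -> R) (x : R) :
  continuous f x -> continuous (fun y => Rabs (f y)) x.
Proof. intros H. apply (continuous_comp f Rabs); [exact H|apply continuous_Rabs]. Qed.

(** The comparison goes through [alpha] pointwise, whence the factor 2; [alpha] itself is never
    integrated. *)
Lemma close_at_RInt_dist (alpha V g1 g2 : R -> R) (M : nat) :
  (0 < M)%nat -> variation_bound alpha V ->
  (forall x, continuous g1 x) -> (forall x, continuous g2 x) ->
  close_at alpha V M g1 -> close_at alpha V M g2 ->
  RInt (fun x => Rabs (g2 x - g1 x)) 0 (2 * PI) <= 2 * (2 * PI / INR M) * (V (2 * PI) - V 0).
Proof.
  intros HM HV C1 C2 H1 H2. apply RInt_cells_le; [exact HM|lra| |intros; apply Rabs_pos| |].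
  - intros x. apply continuous_Rabs_comp.
    apply (@continuous_minus R_UniformSpace R_AbsRing R_NormedModule); auto.
  - intros x y. apply (variation_bound_mono alpha V x y HV).
  - intros k x Hk Hx.
    assert (A1 := H1 k x Hk ltac:(lra)). assert (A2 := H2 k x Hk ltac:(lra)). simpl in A1, A2.
    replace (g2 x - g1 x) with ((g2 x - alpha x) - (g1 x - alpha x)) by ring.
    apply Rle_trans with (1 := Rabs_triang _ _). rewrite Rabs_Ropp. lra.
Qed.

(** The slope on a cell is at most [S * dV / h]. Of the two factors [dV] in its square one is
    bounded by the whole variation [W], the other is summed over the cells. *)
Lemma staircase_energy (s alpha V : R -> R) (M : nat) (S : R) :
  (0 < M)%nat -> variation_bound alpha V -> smooth s ->
  (forall x, x <= 0 -> s x = 0) -> (forall x, 1 <= x -> s x = 1) ->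
  (forall x, Rabs (Derive s x) <= S) ->
  let h := 2 * PI / INR M in
  RInt (fun x => Derive (staircase s alpha h) x ^ 2) 0 (2 * PI)
  <= S ^ 2 * (V (2 * PI) - V 0) ^ 2 / h.
Proof.
  intros HM HV Hs Hs0 Hs1 HS h. assert (Hp := two_PI_pos).
  assert (Hh : 0 < h) by (apply Rdiv_lt_0_compat; [lra|apply lt_0_INR, HM]).
  assert (Hmono := fun x y => variation_bound_mono alpha V x y HV).
  assert (HW := Hmono 0 (2 * PI) ltac:(lra) ltac:(lra) ltac:(lra)).
  set (W := V (2 * PI) - V 0).
  assert (Hsm := smooth_Derive _ (staircase_smooth s alpha h Hs Hs0 Hs1 Hh)).
  assert (Hcont : forall x, continuous (fun x => Derive (staircase s alpha h) x ^ 2) x).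
  { intros x. apply smooth_continuous.
    apply smooth_mult; [exact Hsm|]. apply smooth_mult; [exact Hsm|apply smooth_const]. }
  replace (S ^ 2 * W ^ 2 / h) with ((S ^ 2 * W / h ^ 2) * h * W) by (field; lra).
  assert (HC : 0 <= S ^ 2 * W / h ^ 2).
  { apply Rdiv_le_0_compat; [|apply pow_lt, Hh].
    apply Rmult_le_pos; [apply pow2_ge_0|unfold W; lra]. }
  apply (RInt_cells_le _ V M _ HM HC Hcont (fun x => pow2_ge_0 _) Hmono).
  intros k x Hk Hx. fold h in Hx |- *.
  destruct (cell_bounds M k Hk) as [B1 [B2 B3]]. fold h in B1, B2, B3.
  assert (A1 := HV _ _ B1 B2 B3).
  assert (A2 : V (INR k * h) <= V ((INR k + 1) * h)) by (apply Hmono; assumption).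
  assert (A3 : V ((INR k + 1) * h) - V (INR k * h) <= W).
  { assert (V 0 <= V (INR k * h)) by (apply Hmono; lra).
    assert (V ((INR k + 1) * h) <= V (2 * PI)) by (apply Hmono; lra). unfold W; lra. }
  rewrite INR_IZR_INZ in *. set (z := Z.of_nat k) in *.
  rewrite (Derive_staircase s alpha h Hs Hs0 Hs1 Hh z x Hx).
  set (D := alpha ((IZR z + 1) * h) - alpha (IZR z * h)) in *.
  set (dV := V ((IZR z + 1) * h) - V (IZR z * h)) in *.
  assert (E1 : D ^ 2 <= W * dV).
  { apply Rle_trans with (dV ^ 2).
    - rewrite <- (pow2_abs D). apply pow_incr. split; [apply Rabs_pos|exact A1].
    - unfold dV in *; nra. }
  assert (E2 : Derive s (x / h - IZR z) ^ 2 <= S ^ 2).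
  { rewrite <- pow2_abs. apply pow_incr. split; [apply Rabs_pos|apply HS]. }
  replace ((D / h * Derive s (x / h - IZR z)) ^ 2)
    with (D ^ 2 * Derive s (x / h - IZR z) ^ 2 / h ^ 2) by (field; lra).
  replace (S ^ 2 * W / h ^ 2 * dV) with (W * dV * S ^ 2 / h ^ 2) by (field; lra).
  apply Rmult_le_compat_r; [left; apply Rinv_0_lt_compat, pow_lt, Hh|].
  apply Rmult_le_compat; [apply pow2_ge_0|apply pow2_ge_0|exact E1|exact E2].
Qed.

(** * Comparison of a coordinate of the given curve with its smooth closed approximation *)

Section ClosedCurve.

Variables (f phi alpha V : R -> R) (N : R -> Prop) (r : R) (M : nat).
Hypothesis HM : (0 < M)%nat.
Hypothesis Hf : R_lipschitz f.
Hypothesis Hclosed : f (2 * PI) = f 0.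
Hypothesis HN : negligible N.
Hypothesis HV : variation_bound alpha V.
Hypothesis Hder : forall x, 0 <= x <= 2 * PI -> ~ N x -> is_derive f x (r * phi (alpha x)).
Hypothesis phi_lip : forall x y, Rabs (phi x - phi y) <= Rabs (x - y).
Hypothesis phi_le : forall x, Rabs (phi x) <= 1.
Hypothesis phi_cont : forall x, continuous phi x.

Variable g : R -> R.
Hypothesis Hg : forall x, continuous g x.
Hypothesis Hclose : close_at alpha V M g.

Let h := 2 * PI / INR M.
Let W := V (2 * PI) - V 0.
Let G x := r * phi (g x).

Lemma continuous_speed (x : R) : continuous G x.
Proof.
  apply (@continuous_scal_r R_UniformSpace R_AbsRing R_NormedModule r).
  apply (continuous_comp g phi); auto.
Qed.

(** The difference of [f] and the primitive of [G] is Lipschitz, and on each cell its derivative off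
    [N] is at most [Rabs r] times the variation there, since [phi] is 1-Lipschitz. The increment
    inequality and [cell_sum] do the rest. *)
Lemma close_at_primitive (y : R) :
  0 <= y <= 2 * PI -> Rabs ((f y - RInt G 0 y) - f 0) <= Rabs r * h * W.
Proof.
  intros Hy.
  pose (F := fun y => f y - RInt G 0 y).
  assert (HF : R_lipschitz F).
  { destruct Hf as [K HK]. exists (K + Rabs r). intros x z. unfold F.
    replace (f x - RInt G 0 x - (f z - RInt G 0 z))
      with ((f x - f z) - (RInt G 0 x - RInt G 0 z)) by ring.
    rewrite (RInt_sub G 0 z x continuous_speed).
    apply Rle_trans with (1 := Rabs_triang _ _). rewrite Rabs_Ropp.
    assert (A := HK x z).
    assert (B : Rabs (RInt G z x) <= Rabs (x - z) * Rabs r).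
    { apply RInt_bound; [exact continuous_speed|]. intros u _. unfold G. rewrite Rabs_mult.
      assert (C := phi_le (g u)). assert (D := Rabs_pos r). nra. }
    lra. }
  replace (f y - RInt G 0 y - f 0) with (F y - F 0).
  2:{ unfold F. rewrite RInt_point. unfold zero; simpl. ring. }
  apply (cell_sum F V M (Rabs r) HM (Rabs_pos r)); [|fold h|exact Hy].
  - intros u v. apply (variation_bound_mono alpha V u v HV).
  - intros k u v Hk Hu Huv Hv.
    destruct (cell_bounds M k Hk) as [B1 [B2 B3]]. fold h in B1, B2, B3.
    apply (lipschitz_increment_abs F N u v _ Huv HF HN). intros x Hx HNx.
    exists (r * phi (alpha x) - G x). split.
    + apply (is_derive_minus f (RInt G 0) x); [apply Hder; [lra|exact HNx]|].
      apply is_derive_RInt_cont, continuous_speed.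
    + unfold G. rewrite <- Rmult_minus_distr_l, Rabs_mult.
      apply Rmult_le_compat_l; [apply Rabs_pos|].
      apply Rle_trans with (1 := phi_lip _ _). rewrite Rabs_minus_sym.
      apply Hclose; [exact Hk|]. fold h. lra.
Qed.

(** As [f] closes up, the integral of [G] over the period is exactly the error of the primitive. *)
Lemma close_at_mean : Rabs (mean G) <= Rabs r * h * W / (2 * PI).
Proof.
  assert (Hp := two_PI_pos). assert (A := close_at_primitive (2 * PI) ltac:(lra)).
  rewrite Hclosed in A. replace (f 0 - RInt G 0 (2 * PI) - f 0) with (- RInt G 0 (2 * PI)) in A by ring.
  rewrite Rabs_Ropp in A.
  unfold mean, Rdiv. rewrite Rabs_mult, (Rabs_right (/ (2 * PI))).
  - apply Rmult_le_compat_r; [left; apply Rinv_0_lt_compat, Hp|exact A].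
  - apply Rle_ge; left; apply Rinv_0_lt_compat, Hp.
Qed.

(** The error of the primitive and the correction by the mean contribute [Rabs r * h * W] each. *)
Lemma close_at_prim (y : R) :
  0 <= y <= 2 * PI -> Rabs (prim (f 0) G y - f y) <= 2 * (Rabs r * h * W).
Proof.
  intros Hy. assert (Hp := two_PI_pos).
  assert (A := close_at_primitive y Hy). assert (B := close_at_mean).
  unfold prim. replace (f 0 + (RInt G 0 y - y * mean G) - f y)
    with (- (f y - RInt G 0 y - f 0) + - (y * mean G)) by ring.
  apply Rle_trans with (1 := Rabs_triang _ _). rewrite !Rabs_Ropp, Rabs_mult, (Rabs_right y) by lra.
  assert (y * Rabs (mean G) <= 2 * PI * (Rabs r * h * W / (2 * PI))).
  { apply Rmult_le_compat; [lra|apply Rabs_pos|lra|exact B]. }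
  replace (2 * PI * (Rabs r * h * W / (2 * PI))) with (Rabs r * h * W) in H by (field; lra).
  lra.
Qed.

End ClosedCurve.

(** * Paths of closed curves with prescribed angle function *)

Lemma periodic_IZR (T : Type) (f : R -> T) (k : Z) (x : R) :
  (forall x, f (x + 2 * PI) = f x) -> f (x + 2 * PI * IZR k) = f x.
Proof.
  intros H.
  assert (Hn : forall n y, f (y + 2 * PI * INR n) = f y).
  { induction n as [|n IH]; intros y.
    - simpl. rewrite Rmult_0_r, Rplus_0_r. reflexivity.
    - rewrite S_INR, <- (IH y), <- (H (y + 2 * PI * INR n)). f_equal. ring. }
  destruct (Z_le_dec 0 k) as [Hk|Hk].
  - rewrite <- (Z2Nat.id k Hk), <- INR_IZR_INZ. apply Hn.
  - rewrite <- (Hn (Z.to_nat (- k)) (x + 2 * PI * IZR k)).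
    rewrite INR_IZR_INZ, Z2Nat.id, opp_IZR by lia. f_equal. ring.
Qed.

Lemma cos_2PI_period (k : Z) (x : R) : cos (x + 2 * PI * IZR k) = cos x.
Proof.
  apply (periodic_IZR R cos). intros y. rewrite <- (cos_period y 1). f_equal. simpl. ring.
Qed.

Lemma sin_2PI_period (k : Z) (x : R) : sin (x + 2 * PI * IZR k) = sin x.
Proof.
  apply (periodic_IZR R sin). intros y. rewrite <- (sin_period y 1). f_equal. simpl. ring.
Qed.

Lemma prim_period (p : R) (f : R -> R) (x : R) :
  (forall x, continuous f x) -> (forall x, f (x + 2 * PI) = f x) ->
  prim p f (x + 2 * PI) = prim p f x.
Proof.
  intros Hf HT. assert (Hp := two_PI_pos). unfold prim.
  assert (A := RInt_sub f 0 (2 * PI) (x + 2 * PI) Hf).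
  assert (B : RInt f (2 * PI) (x + 2 * PI) = RInt f 0 x).
  { replace (RInt f (2 * PI) (x + 2 * PI))
      with (RInt f (1 * 0 + 2 * PI) (1 * x + 2 * PI)) by (f_equal; ring).
    rewrite <- (RInt_comp_lin f 1 (2 * PI) 0 x) by (apply ex_RInt_cont, Hf).
    apply RInt_ext. intros y _. unfold scal; simpl; unfold mult; simpl.
    rewrite !Rmult_1_l. apply HT. }
  rewrite B in A. unfold mean.
  replace (RInt f 0 (x + 2 * PI)) with (RInt f 0 x + RInt f 0 (2 * PI)) by lra.
  field. lra.
Qed.

(** The integral and the subtracted multiple of the mean are each bounded by the integral of [g]. *)
Lemma Rabs_prim_le (f g : R -> R) (x : R) :
  (forall x, continuous f x) -> (forall x, continuous g x) ->
  (forall x, Rabs (f x) <= g x) -> 0 <= x <= 2 * PI ->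
  Rabs (prim 0 f x) <= 2 * RInt g 0 (2 * PI).
Proof.
  intros Hf Hg Hfg Hx. assert (Hp := two_PI_pos).
  assert (Hg0 : forall x, 0 <= g x).
  { intros y. apply Rle_trans with (2 := Hfg y), Rabs_pos. }
  assert (A : forall y, 0 <= y <= 2 * PI -> Rabs (RInt f 0 y) <= RInt g 0 (2 * PI)).
  { intros y Hy. apply Rle_trans with (RInt g 0 y).
    - apply Rle_trans with (RInt (fun t => Rabs (f t)) 0 y).
      + apply abs_RInt_le; [lra|apply ex_RInt_cont, Hf].
      + apply RInt_le; [lra| |apply ex_RInt_cont, Hg|intros; apply Hfg].
        apply ex_RInt_cont. intros z. apply continuous_Rabs_comp, Hf.
    - assert (B := RInt_sub g 0 y (2 * PI) Hg).
      assert (0 <= RInt g y (2 * PI)); [|lra].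
      apply RInt_ge_0; [lra|apply ex_RInt_cont, Hg|auto]. }
  unfold prim, mean. rewrite Rplus_0_l. apply Rle_trans with (1 := Rabs_triang _ _).
  rewrite Rabs_Ropp, Rabs_mult, (Rabs_right x) by lra.
  unfold Rdiv. rewrite Rabs_mult, (Rabs_right (/ (2 * PI))).
  2:{ apply Rle_ge; left; apply Rinv_0_lt_compat, Hp. }
  assert (A1 := A x Hx). assert (A2 := A (2 * PI) ltac:(lra)).
  set (I := Rabs (RInt f 0 (2 * PI))) in *. set (J := RInt g 0 (2 * PI)) in *.
  assert (HI : 0 <= I) by apply Rabs_pos.
  assert (x * (I * / (2 * PI)) <= J); [|lra].
  apply Rle_trans with (2 * PI * (I * / (2 * PI))).
  - apply Rmult_le_compat_r; [|lra].
    apply Rmult_le_pos; [exact HI|left; apply Rinv_0_lt_compat, Hp].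
  - replace (2 * PI * (I * / (2 * PI))) with I by (field; lra). exact A2.
Qed.

(* Cauchy-Schwarz bounds the normal velocity by the velocity [(a, b)] and [kappa ^ 2 * speed] by
   [|c_thth| ^ 2 / speed ^ 3], where [c_thth = (w, z)]. *)
Lemma energy_density_le (A r q T u v w z a b : R) :
  0 < A -> 0 < r -> 0 <= q ->
  r ^ 2 / 4 <= u ^ 2 + v ^ 2 <= 4 * r ^ 2 -> w ^ 2 + z ^ 2 <= r ^ 2 * q ->
  a ^ 2 + b ^ 2 <= T ->
  let N := sqrt (u ^ 2 + v ^ 2) in
  (1 + A * ((u * z - v * w) / N ^ 3) ^ 2) * (a * (- v / N) + b * (u / N)) ^ 2 * N
  <= T * (2 * r + 8 * A / r * q).
Proof.
  intros HA Hr Hq [H1 H2] Hwz Hab N.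
  assert (Hr2 : 0 < r ^ 2) by (apply pow_lt, Hr).
  assert (HN2 : N ^ 2 = u ^ 2 + v ^ 2) by (apply pow2_sqrt; lra).
  assert (HN : 0 < N) by (apply sqrt_lt_R0; lra).
  assert (HNlo : r / 2 <= N).
  { apply Rsqr_incr_0_var; [|lra]. unfold Rsqr. nra. }
  assert (HNhi : N <= 2 * r).
  { apply Rsqr_incr_0_var; [|lra]. unfold Rsqr. nra. }
  assert (HT : 0 <= T) by nra.
  assert (E1 : (a * (- v / N) + b * (u / N)) ^ 2 <= T).
  { replace ((a * (- v / N) + b * (u / N)) ^ 2) with ((b * u - a * v) ^ 2 / N ^ 2) by (field; lra).
    apply Rmult_le_reg_r with (N ^ 2); [apply pow_lt, HN|].
    unfold Rdiv. rewrite Rmult_assoc, Rinv_l, Rmult_1_r by (apply Rgt_not_eq, pow_lt, HN).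
    rewrite HN2. apply Rle_trans with ((a ^ 2 + b ^ 2) * (u ^ 2 + v ^ 2)); [|nra].
    assert (0 <= (a * u + b * v) ^ 2) by apply pow2_ge_0. nra. }
  assert (E2 : ((u * z - v * w) / N ^ 3) ^ 2 * N <= 8 * q / r).
  { replace (((u * z - v * w) / N ^ 3) ^ 2 * N) with ((u * z - v * w) ^ 2 / N ^ 5) by (field; lra).
    assert (C : (u * z - v * w) ^ 2 <= N ^ 2 * (r ^ 2 * q)).
    { rewrite HN2. apply Rle_trans with ((u ^ 2 + v ^ 2) * (w ^ 2 + z ^ 2)); [|nra].
      assert (0 <= (u * w + v * z) ^ 2) by apply pow2_ge_0. nra. }
    apply Rle_trans with (N ^ 2 * (r ^ 2 * q) / N ^ 5).
    - apply Rmult_le_compat_r; [left; apply Rinv_0_lt_compat, pow_lt, HN|exact C].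
    - replace (N ^ 2 * (r ^ 2 * q) / N ^ 5) with (r ^ 2 * q * / N ^ 3) by (field; lra).
      replace (8 * q / r) with (r ^ 2 * q * / (r / 2) ^ 3) by (field; lra).
      apply Rmult_le_compat_l; [nra|].
      apply Rinv_le_contravar; [apply pow_lt; lra|]. apply pow_incr; lra. }
  set (E := (a * (- v / N) + b * (u / N)) ^ 2) in *.
  set (K := ((u * z - v * w) / N ^ 3) ^ 2) in *.
  assert (HE : 0 <= E) by apply pow2_ge_0.
  assert (HK : 0 <= K) by apply pow2_ge_0.
  replace ((1 + A * K) * E * N) with (E * (N + A * (K * N))) by ring.
  replace (8 * A / r * q) with (A * (8 * q / r)) by (field; lra).
  assert (A * (K * N) <= A * (8 * q / r)) by (apply Rmult_le_compat_l; lra).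
  assert (0 <= A * (K * N)) by (apply Rmult_le_pos; [lra|apply Rmult_le_pos; lra]).
  apply Rmult_le_compat; lra.
Qed.

Definition angle_curve (p : pt) (r : R) (g : R -> R) (x : R) : pt :=
  (prim (fst p) (fun y => r * cos (g y)) x, prim (snd p) (fun y => r * sin (g y)) x).

Section AnglePath.

Variables (p : pt) (r : R) (al : R -> R -> R) (k : Z).
Hypothesis Hr : r <> 0.
Hypothesis Hal : jointly_smooth al.
Hypothesis Hper : forall t x, al t (x + 2 * PI) = al t x + 2 * PI * IZR k.
Hypothesis Hmean : forall t, Rabs (mean (fun x => r * cos (al t x))) <= Rabs r / 4 /\
                             Rabs (mean (fun x => r * sin (al t x))) <= Rabs r / 4.

Let c (t : R) : R -> pt := angle_curve p r (al t).
Let X (t x : R) : R := r * cos (al t x).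
Let Y (t x : R) : R := r * sin (al t x).

Lemma angle_cos_smooth : jointly_smooth X.
Proof.
  intros n. apply (diff2_mult n (fun _ _ => r)); [apply (diff2_fst n (fun _ => r)), smooth_const|].
  apply diff2_sin_cos, Hal.
Qed.

Lemma angle_sin_smooth : jointly_smooth Y.
Proof.
  intros n. apply (diff2_mult n (fun _ _ => r)); [apply (diff2_fst n (fun _ => r)), smooth_const|].
  apply diff2_sin_cos, Hal.
Qed.

Lemma jointly_smooth_continuous (f : R -> R -> R) : jointly_smooth f -> jointly_continuous f.
Proof. intros H. exact (diff2_continuity O f (H O)). Qed.

Lemma angle_dcurve (t x : R) : dcurve (c t) x = (X t x - mean (X t), Y t x - mean (Y t)).
Proof.
  unfold dcurve, c, angle_curve. simpl. f_equal; apply is_derive_unique, is_derive_prim;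
    intros y; [apply (jointly_continuous_slice X)|apply (jointly_continuous_slice Y)];
    apply jointly_smooth_continuous; [exact angle_cos_smooth|exact angle_sin_smooth].
Qed.

(** Before the correction the velocity lies on the circle of radius [Rabs r]; the subtracted mean
    has squared norm at most [r ^ 2 / 8], so it cannot bring the speed near 0. *)
Lemma angle_speed (t x : R) :
  r ^ 2 / 4 <= (X t x - mean (X t)) ^ 2 + (Y t x - mean (Y t)) ^ 2 <= 4 * r ^ 2.
Proof.
  destruct (Hmean t) as [H1 H2]. fold (X t) in H1. fold (Y t) in H2.
  assert (HXY : X t x ^ 2 + Y t x ^ 2 = r ^ 2).
  { unfold X, Y. assert (E := sin2_cos2 (al t x)). unfold Rsqr in E.
    transitivity (r ^ 2 * (sin (al t x) * sin (al t x) + cos (al t x) * cos (al t x))); [ring|].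
    rewrite E. ring. }
  assert (Q : forall m, Rabs m <= Rabs r / 4 -> m ^ 2 <= r ^ 2 / 16).
  { intros m Hm. rewrite <- (pow2_abs m), <- (pow2_abs r).
    replace (Rabs r ^ 2 / 16) with ((Rabs r / 4) ^ 2) by field.
    apply pow_incr. split; [apply Rabs_pos|exact Hm]. }
  apply Q in H1. apply Q in H2.
  set (a := X t x) in *. set (b := Y t x) in *. set (m := mean (X t)) in *. set (n := mean (Y t)) in *.
  (* These squares encode [(a - m) ^ 2 >= a ^ 2 / 2 - m ^ 2] and
     [(a - m) ^ 2 <= 2 * a ^ 2 + 2 * m ^ 2], and the same for [b] and [n]. *)
  assert (0 <= (a - 2 * m) ^ 2) by apply pow2_ge_0.
  assert (0 <= (b - 2 * n) ^ 2) by apply pow2_ge_0.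
  assert (0 <= (a + m) ^ 2) by apply pow2_ge_0.
  assert (0 <= (b + n) ^ 2) by apply pow2_ge_0.
  split; nra.
Qed.

Lemma angle_path_imm : is_path_imm c.
Proof.
  assert (HX := angle_cos_smooth). assert (HY := angle_sin_smooth).
  split; [|split; [|split]].
  - apply (smooth2_prim (fst p) X), jointly_smooth_smooth2, HX.
  - apply (smooth2_prim (snd p) Y), jointly_smooth_smooth2, HY.
  - intros t x. unfold c, angle_curve. f_equal; apply prim_period; intros y.
    + apply (jointly_continuous_slice X), jointly_smooth_continuous, HX.
    + rewrite Hper, cos_2PI_period. reflexivity.
    + apply (jointly_continuous_slice Y), jointly_smooth_continuous, HY.
    + rewrite Hper, sin_2PI_period. reflexivity.
  - intros t x _ E. rewrite angle_dcurve in E. injection E as E1 E2.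
    assert (S := angle_speed t x). rewrite E1, E2 in S.
    assert (0 < r ^ 2) by (apply pow2_gt_0, Hr). lra.
Qed.

Lemma is_derive_angle (t x : R) :
  partial1 X t x = r * (- sin (al t x) * partial1 al t x) /\ partial1 Y t x = r * (cos (al t x) * partial1 al t x) /\
  partial2 X t x = r * (- sin (al t x) * partial2 al t x) /\ partial2 Y t x = r * (cos (al t x) * partial2 al t x).
Proof.
  destruct (jointly_smooth_is_derive al Hal) as [D1 [D2 _]].
  specialize (D1 t x). specialize (D2 t x).
  refine (conj _ (conj _ (conj _ _))); apply is_derive_unique; unfold X, Y; apply is_derive_scal.
  - rewrite Rmult_comm. apply (is_derive_comp cos (fun s => al s x) t _ _ (is_derive_cos _) D1).
  - rewrite Rmult_comm. apply (is_derive_comp sin (fun s => al s x) t _ _ (is_derive_sin _) D1).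
  - rewrite Rmult_comm. apply (is_derive_comp cos (fun s => al t s) x _ _ (is_derive_cos _) D2).
  - rewrite Rmult_comm. apply (is_derive_comp sin (fun s => al t s) x _ _ (is_derive_sin _) D2).
Qed.

Let density (A t x : R) : R :=
  let u := X t x - mean (X t) in
  let v := Y t x - mean (Y t) in
  let N := sqrt (u ^ 2 + v ^ 2) in
  (1 + A * ((u * partial2 Y t x - v * partial2 X t x) / N ^ 3) ^ 2)
  * (prim 0 (partial1 X t) x * (- v / N) + prim 0 (partial1 Y t) x * (u / N)) ^ 2 * N.

(** The mean is constant in [x] and drops out of the second space derivative; the base point is
    constant in time, so the velocity of the path has base point 0. *)
Lemma angle_density (A t x : R) :
  (1 + A * kappa c t x ^ 2) * pdot (c_t c t x) (normal c t x) ^ 2 * pnorm (c_th c t x)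
  = density A t x.
Proof.
  destruct (jointly_smooth_is_derive X angle_cos_smooth) as [X1 [X2 [SX1 _]]].
  destruct (jointly_smooth_is_derive Y angle_sin_smooth) as [Y1 [Y2 [SY1 _]]].
  assert (E1 : c_th c t x = (X t x - mean (X t), Y t x - mean (Y t))) by apply angle_dcurve.
  assert (E2 : c_thth c t x = (partial2 X t x, partial2 Y t x)).
  { unfold c_thth, c_th. f_equal.
    - rewrite (Derive_ext _ (fun s => X t s - mean (X t))) by (intros s; rewrite angle_dcurve; reflexivity).
      apply is_derive_unique. assert (H := X2 t x).
      replace (partial2 X t x) with (partial2 X t x - 0) by ring.
      apply (is_derive_minus (fun s => X t s) (fun _ => mean (X t)) x _ _ H).
      apply (@is_derive_const R_AbsRing).
    - rewrite (Derive_ext _ (fun s => Y t s - mean (Y t))) by (intros s; rewrite angle_dcurve; reflexivity).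
      apply is_derive_unique. assert (H := Y2 t x).
      replace (partial2 Y t x) with (partial2 Y t x - 0) by ring.
      apply (is_derive_minus (fun s => Y t s) (fun _ => mean (Y t)) x _ _ H).
      apply (@is_derive_const R_AbsRing). }
  assert (E3 : c_t c t x = (prim 0 (partial1 X t) x, prim 0 (partial1 Y t) x)).
  { unfold c_t, c, angle_curve. simpl. f_equal; apply is_derive_unique.
    - apply (is_derive_prim_parameter (fst p) X (partial1 X)); [| |exact X1];
        apply jointly_smooth_continuous; [exact angle_cos_smooth|exact SX1].
    - apply (is_derive_prim_parameter (snd p) Y (partial1 Y)); [| |exact Y1];
        apply jointly_smooth_continuous; [exact angle_sin_smooth|exact SY1]. }
  unfold kappa, normal. rewrite E1, E2, E3. reflexivity.
Qed.

Lemma continuity_2d_pt_pow (f : R -> R -> R) (n : nat) (t x : R) :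
  continuity_2d_pt f t x -> continuity_2d_pt (fun u v => f u v ^ n) t x.
Proof.
  intros H. induction n as [|n IH]; simpl; [apply continuity_2d_pt_const|].
  apply continuity_2d_pt_mult; assumption.
Qed.

Lemma continuity_2d_pt_div (f g : R -> R -> R) (t x : R) :
  continuity_2d_pt f t x -> continuity_2d_pt g t x -> g t x <> 0 ->
  continuity_2d_pt (fun u v => f u v / g u v) t x.
Proof. intros Hf Hg H. apply continuity_2d_pt_mult; [exact Hf|]. apply continuity_2d_pt_inv; assumption. Qed.

(** Both integrals in [hor_length] can be estimated only once they are known to exist; continuity of
    the density gives the inner one, and continuity of [energy] the outer one. *)
Lemma density_continuous (A : R) : jointly_continuous (density A).
Proof.
  destruct (jointly_smooth_is_derive X angle_cos_smooth) as [_ [_ [X1 X2]]].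
  destruct (jointly_smooth_is_derive Y angle_sin_smooth) as [_ [_ [Y1 Y2]]].
  intros t x. unfold density.
  assert (CU : continuity_2d_pt (fun t x => X t x - mean (X t)) t x).
  { apply continuity_2d_pt_minus; [|apply jointly_continuous_mean];
      apply jointly_smooth_continuous, angle_cos_smooth. }
  assert (CV : continuity_2d_pt (fun t x => Y t x - mean (Y t)) t x).
  { apply continuity_2d_pt_minus; [|apply jointly_continuous_mean];
      apply jointly_smooth_continuous, angle_sin_smooth. }
  assert (CN : continuity_2d_pt
    (fun t x => sqrt ((X t x - mean (X t)) ^ 2 + (Y t x - mean (Y t)) ^ 2)) t x).
  { apply (continuity_1d_2d_pt_comp sqrt
      (fun t x => (X t x - mean (X t)) ^ 2 + (Y t x - mean (Y t)) ^ 2)).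
    - apply continuity_pt_sqrt. assert (S := angle_speed t x).
      assert (0 < r ^ 2) by (apply pow2_gt_0, Hr). lra.
    - apply continuity_2d_pt_plus; apply continuity_2d_pt_pow; assumption. }
  assert (HN : sqrt ((X t x - mean (X t)) ^ 2 + (Y t x - mean (Y t)) ^ 2) <> 0).
  { apply Rgt_not_eq, sqrt_lt_R0. assert (S := angle_speed t x).
    assert (0 < r ^ 2) by (apply pow2_gt_0, Hr). lra. }
  apply continuity_2d_pt_mult; [|exact CN].
  apply continuity_2d_pt_mult.
  - apply continuity_2d_pt_plus; [apply continuity_2d_pt_const|].
    apply continuity_2d_pt_mult; [apply continuity_2d_pt_const|].
    apply (continuity_2d_pt_pow (fun t x => _ / _)). apply continuity_2d_pt_div.
    + apply continuity_2d_pt_minus; apply continuity_2d_pt_mult; try assumption;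
        apply jointly_smooth_continuous; assumption.
    + apply (continuity_2d_pt_pow (fun t x => sqrt _)), CN.
    + apply pow_nonzero, HN.
  - apply (continuity_2d_pt_pow (fun t x => _ + _)).
    apply continuity_2d_pt_plus; apply continuity_2d_pt_mult.
    + apply jointly_continuous_prim, jointly_smooth_continuous, X1.
    + apply continuity_2d_pt_div; [|exact CN|exact HN]. apply continuity_2d_pt_opp, CV.
    + apply jointly_continuous_prim, jointly_smooth_continuous, Y1.
    + apply continuity_2d_pt_div; [exact CU|exact CN|exact HN].
Qed.

Let energy (A t : R) : R := RInt (fun x =>
  (1 + A * kappa c t x ^ 2) * pdot (c_t c t x) (normal c t x) ^ 2 * pnorm (c_th c t x)) 0 (2 * PI).

Lemma energy_eq (A t : R) : energy A t = RInt (density A t) 0 (2 * PI).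
Proof. apply RInt_ext. intros x _. apply angle_density. Qed.

Lemma energy_continuous (A t : R) : continuous (energy A) t.
Proof.
  apply (continuous_ext (fun t => RInt (density A t) 0 (2 * PI))).
  - intros s. symmetry. apply energy_eq.
  - apply (jointly_continuous_slice1 (fun t x => RInt (density A t) 0 x)).
    apply jointly_continuous_RInt, density_continuous.
Qed.

(** The velocity of the path is controlled uniformly in [x] by the L^1 norm of the time derivative
    of the angle, so it leaves the integral; what remains inside is the squared space derivative,
    since the second derivative of the curve has norm [Rabs r * Rabs (partial2 al t x)]. *)
Lemma angle_energy_le (A t : R) :
  0 < A ->
  energy A t <= 8 * r ^ 2 * RInt (fun x => Rabs (partial1 al t x)) 0 (2 * PI) ^ 2
    * (4 * PI * Rabs r + 8 * A / Rabs r * RInt (fun x => partial2 al t x ^ 2) 0 (2 * PI)).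
Proof.
  intros HA. rewrite energy_eq. assert (Hp := two_PI_pos).
  assert (Hra : 0 < Rabs r) by (apply Rabs_pos_lt, Hr).
  destruct (jointly_smooth_is_derive al Hal) as [_ [_ [A1 A2]]].
  assert (C1 : forall x, continuous (partial1 al t) x)
    by (intros x; apply jointly_continuous_slice, jointly_smooth_continuous, A1).
  assert (C2 : forall x, continuous (partial2 al t) x)
    by (intros x; apply jointly_continuous_slice, jointly_smooth_continuous, A2).
  assert (C2' : forall x, continuous (fun x => partial2 al t x ^ 2) x).
  { intros x. apply (continuous_comp (partial2 al t) (fun y => y ^ 2)); [apply C2|].
    apply (ex_derive_continuous (fun y => y ^ 2)). auto_derive. exact I. }
  assert (C1' : forall x, continuous (fun x => Rabs (partial1 al t x)) x)
    by (intros x; apply continuous_Rabs_comp, C1).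
  set (Q := RInt (fun x => Rabs (partial1 al t x)) 0 (2 * PI)).
  set (P := RInt (fun x => partial2 al t x ^ 2) 0 (2 * PI)).
  (* Each component of the velocity is at most [2 * Rabs r * Q]; the two squares add up to [T]. *)
  set (T := 8 * r ^ 2 * Q ^ 2).
  assert (CB : forall x, continuous (fun x => T * (2 * Rabs r + 8 * A / Rabs r * partial2 al t x ^ 2)) x).
  { intros x. apply (continuous_comp (fun x => partial2 al t x ^ 2)
      (fun y => T * (2 * Rabs r + 8 * A / Rabs r * y))); [apply C2'|].
    apply (ex_derive_continuous (fun y => T * (2 * Rabs r + 8 * A / Rabs r * y))).
    auto_derive. exact I. }
  apply Rle_trans with (RInt (fun x => T * (2 * Rabs r + 8 * A / Rabs r * partial2 al t x ^ 2)) 0 (2 * PI)).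
  - apply RInt_le; [lra| |apply ex_RInt_cont, CB|].
    + apply ex_RInt_cont. intros x. apply jointly_continuous_slice, density_continuous.
    + intros x Hx. destruct (is_derive_angle t x) as [_ [_ [E3 E4]]].
      assert (Hsc := sin2_cos2 (al t x)). unfold Rsqr in Hsc.
      apply energy_density_le; [exact HA|exact Hra|apply pow2_ge_0| | |].
      * rewrite pow2_abs. apply angle_speed.
      * rewrite pow2_abs, E3, E4. apply Req_le.
        transitivity (r ^ 2 * partial2 al t x ^ 2
          * (sin (al t x) * sin (al t x) + cos (al t x) * cos (al t x))); [ring|].
        rewrite Hsc. ring.
      * assert (B : forall F, (forall x, continuous F x) ->
            (forall x, Rabs (F x) <= Rabs r * Rabs (partial1 al t x)) ->
            prim 0 F x ^ 2 <= 4 * r ^ 2 * Q ^ 2).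
        { intros F HF HFb.
          assert (B := Rabs_prim_le F (fun x => Rabs r * Rabs (partial1 al t x)) x HF).
          rewrite <- (pow2_abs (prim 0 F x)).
          replace (4 * r ^ 2 * Q ^ 2) with ((2 * (Rabs r * Q)) ^ 2).
          2:{ rewrite !Rpow_mult_distr, pow2_abs. ring. }
          apply pow_incr. split; [apply Rabs_pos|].
          replace (Rabs r * Q) with (RInt (fun x => Rabs r * Rabs (partial1 al t x)) 0 (2 * PI)).
          - apply B; [|exact HFb|lra].
            intros y. apply (@continuous_scal_r R_UniformSpace R_AbsRing R_NormedModule (Rabs r)), C1'.
          - apply (@RInt_scal R_CompleteNormedModule (fun x => Rabs (partial1 al t x))).
            apply ex_RInt_cont, C1'. }
        destruct (jointly_smooth_is_derive X angle_cos_smooth) as [_ [_ [X1 _]]].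
        destruct (jointly_smooth_is_derive Y angle_sin_smooth) as [_ [_ [Y1 _]]].
        assert (B1 : prim 0 (partial1 X t) x ^ 2 <= 4 * r ^ 2 * Q ^ 2).
        { apply B.
          - intros y. apply jointly_continuous_slice, jointly_smooth_continuous, X1.
          - intros y. destruct (is_derive_angle t y) as [-> _].
            rewrite !Rabs_mult, Rabs_Ropp. apply Rmult_le_compat_l; [lra|].
            assert (S := SIN_bound (al t y)). assert (Rabs (sin (al t y)) <= 1) by (apply Rabs_le; lra).
            assert (G := Rabs_pos (partial1 al t y)). nra. }
        assert (B2 : prim 0 (partial1 Y t) x ^ 2 <= 4 * r ^ 2 * Q ^ 2).
        { apply B.
          - intros y. apply jointly_continuous_slice, jointly_smooth_continuous, Y1.
          - intros y. destruct (is_derive_angle t y) as [_ [-> _]].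
            rewrite !Rabs_mult. apply Rmult_le_compat_l; [lra|].
            assert (S := COS_bound (al t y)). assert (Rabs (cos (al t y)) <= 1) by (apply Rabs_le; lra).
            assert (G := Rabs_pos (partial1 al t y)). nra. }
        unfold T. lra.
  - apply Req_le. unfold T, P.
    rewrite (@RInt_scal R_CompleteNormedModule (fun x => 2 * Rabs r + 8 * A / Rabs r * partial2 al t x ^ 2)).
    + change (8 * r ^ 2 * Q ^ 2 * RInt (fun x => 2 * Rabs r + 8 * A / Rabs r * partial2 al t x ^ 2) 0 (2 * PI)
        = 8 * r ^ 2 * Q ^ 2 * (4 * PI * Rabs r + 8 * A / Rabs r * RInt (fun x => partial2 al t x ^ 2) 0 (2 * PI))).
      f_equal.
      rewrite (@RInt_plus R_CompleteNormedModule (fun _ => 2 * Rabs r)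
                 (fun x => 8 * A / Rabs r * partial2 al t x ^ 2)).
      * rewrite RInt_const.
        rewrite (@RInt_scal R_CompleteNormedModule (fun x => partial2 al t x ^ 2)) by (apply ex_RInt_cont, C2').
        unfold plus, scal; simpl; unfold mult; simpl. ring.
      * apply (@ex_RInt_const R_NormedModule).
      * apply ex_RInt_cont. intros y.
        apply (@continuous_scal_r R_UniformSpace R_AbsRing R_NormedModule (8 * A / Rabs r)), C2'.
    + apply ex_RInt_cont. intros x.
      apply (continuous_comp (fun x => partial2 al t x ^ 2)
        (fun y => 2 * Rabs r + 8 * A / Rabs r * y)); [apply C2'|].
      apply (ex_derive_continuous (fun y => 2 * Rabs r + 8 * A / Rabs r * y)).
      auto_derive. exact I.
Qed.

Lemma hor_length_le (A : R) (w : R -> R) :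
  (forall t, continuous w t) -> (forall t, 0 <= t <= 1 -> 0 <= w t) ->
  (forall t, 0 <= t <= 1 -> energy A t <= w t ^ 2) ->
  hor_length A c <= RInt w 0 1.
Proof.
  intros Cw Hw HE. unfold hor_length. fold (energy A).
  apply RInt_le; [lra| |apply ex_RInt_cont, Cw|].
  - apply ex_RInt_cont. intros t.
    apply (continuous_comp (energy A) sqrt); [apply energy_continuous|apply continuous_sqrt].
  - intros t Ht. rewrite <- (sqrt_pow2 (w t)) by (apply Hw; lra).
    apply sqrt_le_1_alt, HE. lra.
Qed.

End AnglePath.

(** * Interpolation in time *)

(** The profile [u] is a parameter, so that the same truncation facts serve for the step, for its
    derivative and for the constants they reach. *)
Fixpoint shifted_sum (u : R -> R) (D : nat -> R) (K : nat) (t : R) : R :=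
  match K with
  | O => 0
  | S K => shifted_sum u D K t + u (t - INR K) * D K
  end.

Lemma shifted_sum_truncate (u : R -> R) (D : nat -> R) (j K : nat) (t : R) :
  (forall x, x <= 0 -> u x = 0) -> (j <= K)%nat -> t <= INR j ->
  shifted_sum u D K t = shifted_sum u D j t.
Proof.
  intros Hu HjK Ht. induction HjK as [|K HjK IH]; [reflexivity|].
  simpl. rewrite IH, Hu; [ring|]. apply le_INR in HjK. lra.
Qed.

Lemma shifted_sum_const (u : R -> R) (D : nat -> R) (v : R) (j : nat) (t : R) :
  (forall x, 1 <= x -> u x = v) -> INR j <= t ->
  shifted_sum u D j t = shifted_sum (fun _ => v) D j 0.
Proof.
  intros Hu. induction j as [|j IH]; intros Ht; [reflexivity|].
  rewrite S_INR in Ht. simpl. rewrite IH, Hu by lra. reflexivity.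
Qed.

Lemma shifted_sum_telescope (a : nat -> R) (j : nat) :
  shifted_sum (fun _ => 1) (fun i => a (S i) - a i) j 0 = a j - a O.
Proof. induction j as [|j IH]; simpl; [ring|]. rewrite IH. ring. Qed.

Lemma shifted_sum_zero (D : nat -> R) (j : nat) : shifted_sum (fun _ => 0) D j 0 = 0.
Proof. induction j as [|j IH]; simpl; [reflexivity|]. rewrite IH. ring. Qed.

Lemma is_derive_shifted_sum (s : R -> R) (D : nat -> R) (K : nat) (t : R) :
  smooth s -> is_derive (shifted_sum s D K) t (shifted_sum (Derive s) D K t).
Proof.
  intros Hs. induction K as [|K IH]; [apply (@is_derive_const R_AbsRing)|].
  apply (is_derive_plus (shifted_sum s D K) (fun t => s (t - INR K) * D K) t _ _ IH).
  assert (H := is_derive_affine s (- INR K) 1 t _ (smooth_is_derive s (- INR K + 1 * t) Hs)).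
  assert (H' := is_derive_scal _ t (D K) _ H).
  replace (Derive s (t - INR K) * D K) with (D K * (1 * Derive s (- INR K + 1 * t))).
  - revert H'. apply is_derive_ext. intros y. replace (- INR K + 1 * y) with (y - INR K) by ring.
    apply Rmult_comm.
  - replace (- INR K + 1 * t) with (t - INR K) by ring. ring.
Qed.

(** Written as a sum of steps, the interpolation is smooth in time without any gluing. For [t]
    between [j] and [j + 1] the earlier steps have saturated and telescope to [a j], the later ones
    vanish. *)
Definition interp (s : R -> R) (a : nat -> R -> R) (K : nat) (t x : R) : R :=
  a O x + shifted_sum s (fun i => a (S i) x - a i x) K t.

Lemma cell_exists (K : nat) (t : R) :
  (0 < K)%nat -> 0 <= t <= INR K -> exists j, (j < K)%nat /\ INR j <= t <= INR j + 1.
Proof.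
  induction K as [|K IH]; intros HK Ht; [lia|].
  destruct (Rle_dec (INR K) t) as [H|H].
  - exists K. rewrite S_INR in Ht. split; [lia|lra].
  - destruct K as [|K]; [simpl in H; lra|].
    destruct (IH ltac:(lia) ltac:(lra)) as [j [Hj Hjt]]. exists j. split; [lia|exact Hjt].
Qed.

Section Interpolation.

Variables (s : R -> R) (a : nat -> R -> R).
Hypothesis Hs : smooth s.
Hypothesis Hs0 : forall x, x <= 0 -> s x = 0.
Hypothesis Hs1 : forall x, 1 <= x -> s x = 1.
Hypothesis Hs01 : forall x, 0 <= s x <= 1.
Hypothesis Hsd : forall x, x <= 0 \/ 1 <= x -> Derive s x = 0.
Hypothesis Ha : forall i, smooth (a i).

Lemma interp_cell (K j : nat) (t x : R) :
  (j < K)%nat -> INR j <= t <= INR j + 1 ->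
  interp s a K t x = a j x + (a (S j) x - a j x) * s (t - INR j).
Proof.
  intros HjK Ht. unfold interp.
  rewrite (shifted_sum_truncate s _ (S j) K t Hs0) by (lia || (rewrite S_INR; lra)).
  simpl. rewrite (shifted_sum_const s _ 1 j t Hs1), (shifted_sum_telescope (fun i => a i x)) by lra.
  ring.
Qed.

Lemma interp_nat (K m : nat) (x : R) : (m < K)%nat -> interp s a K (INR m) x = a m x.
Proof.
  intros Hm. rewrite (interp_cell K m) by (lia || lra). rewrite Hs0 by lra. ring.
Qed.

(** Times outside [[0, K]] are included, because the bound on the mean velocity in the study of
    angle paths is assumed for all [t]. *)
Lemma interp_convex (K : nat) (t : R) :
  (0 < K)%nat -> exists j l, 0 <= l <= 1 /\
    forall x, interp s a K t x = a j x + (a (S j) x - a j x) * l.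
Proof.
  intros HK. destruct (Rle_dec t 0) as [H0|H0].
  - exists O, 0. split; [lra|]. intros x. unfold interp.
    rewrite (shifted_sum_truncate s _ O K t Hs0) by (lia || (simpl; lra)). simpl. ring.
  - destruct (Rle_dec t (INR K)) as [H1|H1].
    + destruct (cell_exists K t HK ltac:(lra)) as [j [Hj Hjt]].
      exists j, (s (t - INR j)). split; [apply Hs01|]. intros x. apply interp_cell; assumption.
    + destruct K as [|K]; [lia|]. exists K, 1. split; [lra|]. intros x. unfold interp.
      rewrite (shifted_sum_const s _ 1 (S K) t Hs1), (shifted_sum_telescope (fun i => a i x)) by lra.
      ring.
Qed.

Lemma interp_jointly_smooth (K : nat) (b d : R) :
  jointly_smooth (fun t x => interp s a K (b + d * t) x).
Proof.
  intros n. unfold interp. apply diff2_plus; [apply diff2_snd, Ha|].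
  induction K as [|K IH]; simpl; [apply (diff2_fst n (fun _ => 0)), smooth_const|].
  apply diff2_plus; [exact IH|]. apply (diff2_mult n (fun t _ => s (b + d * t - INR K))).
  - apply (diff2_fst n (fun t => s (b + d * t - INR K))).
    replace (fun t => s (b + d * t - INR K)) with (fun t => s ((b - INR K) + d * t))
      by (extensionality t; f_equal; ring).
    apply smooth_affine, Hs.
  - apply (diff2_snd n (fun x => a (S K) x - a K x)).
    replace (fun x => a (S K) x - a K x) with (fun x => a (S K) x + (-1) * a K x)
      by (extensionality x; ring).
    apply smooth_plus; [apply Ha|]. apply (smooth_mult (fun _ => -1)); [apply smooth_const|apply Ha].
Qed.

Lemma interp_time_derivative (K j : nat) (b d t x : R) :
  (j < K)%nat -> INR j <= b + d * t <= INR j + 1 ->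
  partial1 (fun t x => interp s a K (b + d * t) x) t x
  = d * (Derive s (b + d * t - INR j) * (a (S j) x - a j x)).
Proof.
  intros HjK Ht. apply is_derive_unique.
  assert (H : is_derive (fun u => interp s a K u x) (b + d * t)
                (Derive s (b + d * t - INR j) * (a (S j) x - a j x))).
  { assert (H := is_derive_shifted_sum s (fun i => a (S i) x - a i x) K (b + d * t) Hs).
    rewrite (shifted_sum_truncate (Derive s) _ (S j) K) in H
      by (lia || (rewrite S_INR; lra) || (intros; apply Hsd; lra)).
    simpl in H. rewrite (shifted_sum_const (Derive s) _ 0 j), shifted_sum_zero, Rplus_0_l in H
      by (lra || (intros; apply Hsd; lra)).
    rewrite <- (Rplus_0_l (Derive s _ * _)).
    apply (is_derive_plus (fun _ => a O x) _ _ 0); [|exact H].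
    apply (@is_derive_const R_AbsRing). }
  exact (is_derive_affine (fun u => interp s a K u x) b d t _ H).
Qed.

Lemma interp_space_derivative (K j : nat) (b d t x : R) :
  (j < K)%nat -> INR j <= b + d * t <= INR j + 1 ->
  partial2 (fun t x => interp s a K (b + d * t) x) t x
  = Derive (a j) x + (Derive (a (S j)) x - Derive (a j) x) * s (b + d * t - INR j).
Proof.
  intros HjK Ht. apply is_derive_unique.
  apply (is_derive_ext (fun y => a j y + (a (S j) y - a j y) * s (b + d * t - INR j)));
    [intros y; symmetry; apply interp_cell; assumption|].
  set (l := s (b + d * t - INR j)).
  assert (A0 := smooth_is_derive (a j) x (Ha j)).
  assert (A1 := smooth_is_derive (a (S j)) x (Ha (S j))).
  apply (is_derive_plus (a j) (fun y => (a (S j) y - a j y) * l) x); [exact A0|].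
  rewrite Rmult_comm.
  apply (is_derive_ext (fun y => l * (a (S j) y - a j y))); [intros y; apply Rmult_comm|].
  apply is_derive_scal. apply (is_derive_minus (a (S j)) (a j) x _ _ A1 A0).
Qed.

End Interpolation.

(** * Exponential weights in time *)

Lemma exp_half_pow (n : nat) : exp (- (INR n * ln 2)) = (/ 2) ^ n.
Proof.
  induction n as [|n IH]; [simpl; rewrite Rmult_0_l, Ropp_0; apply exp_0|].
  rewrite S_INR. replace (- ((INR n + 1) * ln 2)) with (- ln 2 + - (INR n * ln 2)) by ring.
  rewrite exp_plus, IH, exp_Ropp, exp_ln by lra. reflexivity.
Qed.

Lemma exp_nondecreasing (x y : R) : x <= y -> exp x <= exp y.
Proof.
  intros [H| ->]; [left; apply exp_increasing, H|apply Rle_refl].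
Qed.

Lemma ln_2_pos : 0 < ln 2.
Proof. rewrite <- ln_1. apply ln_increasing; lra. Qed.

(** The integral is the absolute difference of the two end values over [ln 2]. Bounding it by their
    sum treats both directions of time alike; [sg] is the sign of [d]. *)
Lemma RInt_exp_decay_le (b d : R) :
  RInt (fun t => Rabs d * exp (- ((b + d * t) * ln 2))) 0 1
  <= (exp (- (b * ln 2)) + exp (- ((b + d) * ln 2))) / ln 2.
Proof.
  assert (Hl := ln_2_pos).
  pose (W := fun t => exp (- ((b + d * t) * ln 2))).
  assert (HW : forall sg, RInt (fun t => sg * d * W t) 0 1 = sg * (W 0 - W 1) / ln 2).
  { intros sg. apply is_RInt_unique.
    replace (sg * (W 0 - W 1) / ln 2) with (minus (- sg / ln 2 * W 1) (- sg / ln 2 * W 0)).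
    2:{ unfold minus, plus, opp; simpl. field. lra. }
    apply (is_RInt_derive (fun t => - sg / ln 2 * W t) (fun t => sg * d * W t)).
    - intros t _. unfold W. auto_derive; [exact I|]. field. lra.
    - intros t _. apply (ex_derive_continuous (fun t => sg * d * W t)). unfold W. auto_derive. exact I. }
  assert (W0 : W 0 = exp (- (b * ln 2))) by (unfold W; f_equal; ring).
  assert (W1 : W 1 = exp (- ((b + d) * ln 2))) by (unfold W; f_equal; ring).
  rewrite <- W0, <- W1.
  assert (P0 : 0 < W 0) by apply exp_pos. assert (P1 : 0 < W 1) by apply exp_pos.
  assert (Hsg : exists sg, (sg = 1 \/ sg = -1) /\ Rabs d = sg * d).
  { unfold Rabs. destruct (Rcase_abs d); [exists (-1)|exists 1]; split; (tauto || lra). }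
  destruct Hsg as [sg [Hsg ->]].
  change (RInt (fun t => sg * d * W t) 0 1 <= (W 0 + W 1) / ln 2). rewrite HW.
  apply Rmult_le_compat_r; [left; apply Rinv_0_lt_compat, Hl|].
  destruct Hsg as [->| ->]; lra.
Qed.

(** * The approximating sequence *)

Section Approximation.

Variables (s beta V : R -> R) (k : Z) (S0 : R) (M0 : nat) (p : pt) (r : R).
Hypothesis Hs : smooth s.
Hypothesis Hs0 : forall x, x <= 0 -> s x = 0.
Hypothesis Hs1 : forall x, 1 <= x -> s x = 1.
Hypothesis Hs01 : forall x, 0 <= s x <= 1.
Hypothesis HsS : forall x, Rabs (Derive s x) <= S0.
Hypothesis Hsd : forall x, x <= 0 \/ 1 <= x -> Derive s x = 0.
Hypothesis Hbeta : forall x, beta (x + 2 * PI) = beta x + 2 * PI * IZR k.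
Hypothesis HV : variation_bound beta V.
Hypothesis HM0 : (0 < M0)%nat.
Hypothesis Hr : r <> 0.

Let W := V (2 * PI) - V 0.
Let M (j : nat) : nat := (M0 * 4 ^ j)%nat.
Let h (j : nat) : R := 2 * PI / INR (M j).

Definition approx_angle (j : nat) : R -> R := staircase s beta (2 * PI / INR (M0 * 4 ^ j)).

Let a := approx_angle.

Hypothesis Hmean : forall j g, (forall x, continuous g x) -> close_at beta V (M j) g ->
  Rabs (mean (fun x => r * cos (g x))) <= Rabs r / 4 /\
  Rabs (mean (fun x => r * sin (g x))) <= Rabs r / 4.

Lemma approx_cells_pos (j : nat) : (0 < M j)%nat.
Proof. unfold M. apply Nat.mul_pos_pos; [exact HM0|]. apply Nat.neq_0_lt_0, Nat.pow_nonzero. lia. Qed.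

Lemma approx_width_pos (j : nat) : 0 < h j.
Proof. apply Rdiv_lt_0_compat; [apply two_PI_pos|apply lt_0_INR, approx_cells_pos]. Qed.

Lemma approx_width_S (j : nat) : h (S j) = h j / 4.
Proof.
  unfold h, M. replace (M0 * 4 ^ S j)%nat with (4 * (M0 * 4 ^ j))%nat by (simpl; lia).
  rewrite mult_INR. replace (INR 4) with 4 by (simpl; ring). field.
  apply not_0_INR. assert (H := approx_cells_pos j). unfold M in H. lia.
Qed.

Lemma approx_width_le (j : nat) : h j <= 2 * PI * (/ 4) ^ j.
Proof.
  assert (Hp := two_PI_pos). induction j as [|j IH].
  - unfold h, M. simpl. rewrite Nat.mul_1_r, Rmult_1_r.
    assert (1 <= INR M0) by (apply (le_INR 1); lia).
    apply Rmult_le_reg_r with (INR M0); [lra|]. unfold Rdiv. rewrite Rmult_assoc, Rinv_l by lra.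
    nra.
  - rewrite approx_width_S. simpl. lra.
Qed.

Lemma approx_smooth (j : nat) : smooth (a j).
Proof. apply staircase_smooth; auto. apply approx_width_pos. Qed.

Lemma approx_close (j : nat) : close_at beta V (M j) (a j).
Proof. apply close_at_staircase; assumption. Qed.

Lemma approx_close_S (j : nat) : close_at beta V (M j) (a (S j)).
Proof.
  apply close_at_coarsen; [exact HV|].
  replace (4 * M j)%nat with (M (S j)) by (unfold M; simpl; lia). apply approx_close.
Qed.

Lemma approx_period (j : nat) (x : R) : a j (x + 2 * PI) = a j x + 2 * PI * IZR k.
Proof. apply staircase_period; [apply approx_cells_pos|exact Hbeta]. Qed.

Lemma variation_pos : 0 <= W.
Proof.
  assert (Hp := two_PI_pos).
  assert (H := variation_bound_mono beta V 0 (2 * PI) HV). unfold W. lra.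
Qed.

Definition approx_curve (n : nat) : R -> pt := angle_curve p r (approx_angle n).

(** With [b = m] and [d = n - m] the unit time interval leads from scale [m] to scale [n]; with
    [d = 0] the path stands still. *)
Let al (K : nat) (b d t x : R) : R := interp s a K (b + d * t) x.

Lemma al_jointly_smooth (K : nat) (b d : R) : jointly_smooth (al K b d).
Proof. apply interp_jointly_smooth; [exact Hs|apply approx_smooth]. Qed.

Lemma al_period (K : nat) (b d t x : R) : (0 < K)%nat ->
  al K b d t (x + 2 * PI) = al K b d t x + 2 * PI * IZR k.
Proof.
  intros HK. destruct (interp_convex s a Hs0 Hs1 Hs01 K (b + d * t) HK) as [j [l [_ H]]].
  unfold al. rewrite !H, !approx_period. ring.
Qed.

(** Both neighbouring staircases are close at the coarser of their two scales, hence so is every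
    convex combination of them, and [Hmean] applies at that scale. *)
Lemma al_mean (K : nat) (b d t : R) : (0 < K)%nat ->
  Rabs (mean (fun x => r * cos (al K b d t x))) <= Rabs r / 4 /\
  Rabs (mean (fun x => r * sin (al K b d t x))) <= Rabs r / 4.
Proof.
  intros HK. destruct (interp_convex s a Hs0 Hs1 Hs01 K (b + d * t) HK) as [j [l [Hl H]]].
  apply (Hmean j).
  - intros x. apply (jointly_continuous_slice (al K b d)), jointly_smooth_continuous, al_jointly_smooth.
  - unfold al. intros i x. rewrite H. revert i x.
    apply (close_at_convex beta V (a j) (a (S j)) (M j) l Hl); [apply approx_close|apply approx_close_S].
Qed.

Lemma al_path_imm (K : nat) (b d : R) : (0 < K)%nat ->
  is_path_imm (fun t => angle_curve p r (al K b d t)).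
Proof.
  intros HK. apply (angle_path_imm p r (al K b d) k Hr (al_jointly_smooth K b d)).
  - intros t x. apply al_period, HK.
  - intros t. apply al_mean, HK.
Qed.

Lemma path_imm_slice (c : R -> R -> pt) (t : R) : is_path_imm c -> 0 <= t <= 1 -> is_imm (c t).
Proof.
  intros [H1 [H2 [H3 H4]]] Ht. split; [|split; [|split]].
  - apply (smooth2_slice (fun t x => fst (c t x)) t H1).
  - apply (smooth2_slice (fun t x => snd (c t x)) t H2).
  - intros x. apply H3.
  - intros x. apply H4, Ht.
Qed.

Lemma al_nat (K m : nat) (b d t : R) : (m < K)%nat -> b + d * t = INR m -> al K b d t = a m.
Proof.
  intros Hm Ht. extensionality x. unfold al. rewrite Ht. apply interp_nat; assumption.
Qed.

(** The curve is a slice of a path that stands still at scale [n]. *)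
Lemma approx_imm (n : nat) : is_imm (approx_curve n).
Proof.
  unfold approx_curve. fold (a n). rewrite <- (al_nat (S n) n (INR n) 0 0) by (lia || ring).
  apply (path_imm_slice (fun t => angle_curve p r (al (S n) (INR n) 0 t))); [|lra].
  apply al_path_imm. lia.
Qed.

Variable A : R.
Hypothesis HA : 0 < A.

(** From [8 * r ^ 2 * Q ^ 2] with [Q <= 2 * Rabs d * S0 * h j * W] come the factor 32 and two powers
    of [h j]. One of them stays outside; the other is bounded by [2 * PI] in the length term and
    cancels the [/ h j] of the curvature term. *)
Let B := 32 * r ^ 2 * S0 ^ 2 * W ^ 2 * (8 * PI ^ 2 * Rabs r + 40 * A * S0 ^ 2 * W ^ 2 / Rabs r).

Lemma al_energy_le (K j : nat) (b d t : R) :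
  (j < K)%nat -> INR j <= b + d * t <= INR j + 1 ->
  8 * r ^ 2 * RInt (fun x => Rabs (partial1 (al K b d) t x)) 0 (2 * PI) ^ 2
    * (4 * PI * Rabs r + 8 * A / Rabs r * RInt (fun x => partial2 (al K b d) t x ^ 2) 0 (2 * PI))
  <= d ^ 2 * B * h j.
Proof.
  intros HjK Ht. assert (Hp := two_PI_pos). assert (HW := variation_pos).
  assert (Hra : 0 < Rabs r) by (apply Rabs_pos_lt, Hr).
  assert (HS0 : 0 <= S0) by (apply Rle_trans with (2 := HsS 0), Rabs_pos).
  assert (Hh := approx_width_pos j).
  assert (Ca : forall i x, continuous (a i) x) by (intros; apply smooth_continuous, approx_smooth).
  assert (Cd : forall x, continuous (fun x => Rabs (a (S j) x - a j x)) x).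
  { intros x. apply continuous_Rabs_comp.
    apply (@continuous_minus R_UniformSpace R_AbsRing R_NormedModule); apply Ca. }
  assert (Cp : forall i x, continuous (fun x => Derive (a i) x ^ 2) x).
  { intros i x. apply smooth_continuous. assert (H := smooth_Derive _ (approx_smooth i)).
    apply smooth_mult; [exact H|]. apply smooth_mult; [exact H|apply smooth_const]. }
  destruct (jointly_smooth_is_derive _ (al_jointly_smooth K b d)) as [_ [_ [J1 J2]]].
  set (Q := RInt (fun x => Rabs (partial1 (al K b d) t x)) 0 (2 * PI)).
  set (P := RInt (fun x => partial2 (al K b d) t x ^ 2) 0 (2 * PI)).
  assert (HQ : 0 <= Q <= Rabs d * S0 * (2 * h j * W)).
  { split.
    - apply RInt_ge_0; [lra| |intros; apply Rabs_pos].
      apply ex_RInt_cont. intros x. apply continuous_Rabs_comp.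
      apply (jointly_continuous_slice (partial1 (al K b d))), jointly_smooth_continuous, J1.
    - apply Rle_trans with (Rabs d * S0 * RInt (fun x => Rabs (a (S j) x - a j x)) 0 (2 * PI)).
      + rewrite <- (@RInt_scal R_CompleteNormedModule (fun x => Rabs (a (S j) x - a j x)))
          by (apply ex_RInt_cont, Cd).
        apply RInt_le; [lra| | |].
        * apply ex_RInt_cont. intros x. apply continuous_Rabs_comp.
          apply (jointly_continuous_slice (partial1 (al K b d))), jointly_smooth_continuous, J1.
        * apply ex_RInt_cont. intros x.
          apply (@continuous_scal_r R_UniformSpace R_AbsRing R_NormedModule (Rabs d * S0)), Cd.
        * intros x _. unfold al.
          rewrite (interp_time_derivative s a Hs Hsd K j) by assumption.
          rewrite !Rabs_mult. unfold scal; simpl; unfold mult; simpl. rewrite Rmult_assoc.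
          apply Rmult_le_compat_l; [apply Rabs_pos|].
          apply Rmult_le_compat_r; [apply Rabs_pos|apply HsS].
      + apply Rmult_le_compat_l; [apply Rmult_le_pos; [apply Rabs_pos|exact HS0]|].
        apply (close_at_RInt_dist beta V (a j) (a (S j)) (M j) (approx_cells_pos j) HV);
          try apply Ca; [apply approx_close|apply approx_close_S]. }
  (* The 5 is 1 from scale [j] plus 4 from the next scale, whose cells are four times shorter. *)
  assert (HP : 0 <= P <= 5 * (S0 ^ 2 * W ^ 2 / h j)).
  { split.
    - apply RInt_ge_0; [lra| |intros; apply pow2_ge_0].
      apply ex_RInt_cont. intros x.
      apply (continuous_comp (partial2 (al K b d) t) (fun y => y ^ 2)).
      + apply (jointly_continuous_slice (partial2 (al K b d))), jointly_smooth_continuous, J2.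
      + apply (ex_derive_continuous (fun y => y ^ 2)). auto_derive. exact I.
    - apply Rle_trans with
        (RInt (fun x => Derive (a j) x ^ 2 + Derive (a (S j)) x ^ 2) 0 (2 * PI)).
      + apply RInt_le; [lra| | |].
        * apply ex_RInt_cont. intros x.
          apply (continuous_comp (partial2 (al K b d) t) (fun y => y ^ 2)).
          -- apply (jointly_continuous_slice (partial2 (al K b d))), jointly_smooth_continuous, J2.
          -- apply (ex_derive_continuous (fun y => y ^ 2)). auto_derive. exact I.
        * apply ex_RInt_cont. intros x.
          apply (@continuous_plus R_UniformSpace R_AbsRing R_NormedModule); apply Cp.
        * intros x _. unfold al.
          rewrite (interp_space_derivative s a Hs0 Hs1 approx_smooth K j) by assumption.
          assert (Hl := Hs01 (b + d * t - INR j)). set (l := s (b + d * t - INR j)) in *.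
          set (y := Derive (a j) x). set (z := Derive (a (S j)) x).
          (* This is the defect in the convexity of the square: the square of the mixture is the
             mixture of the squares minus this term. *)
          assert (0 <= l * (1 - l) * (z - y) ^ 2).
          { apply Rmult_le_pos; [apply Rmult_le_pos; lra|apply pow2_ge_0]. }
          assert (0 <= y ^ 2) by apply pow2_ge_0. assert (0 <= z ^ 2) by apply pow2_ge_0.
          assert (0 <= l * y ^ 2) by (apply Rmult_le_pos; lra).
          assert (0 <= (1 - l) * z ^ 2) by (apply Rmult_le_pos; lra).
          replace ((y + (z - y) * l) ^ 2)
            with ((1 - l) * y ^ 2 + l * z ^ 2 - l * (1 - l) * (z - y) ^ 2) by ring.
          lra.
      + rewrite (@RInt_plus R_CompleteNormedModule (fun x => Derive (a j) x ^ 2)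
                   (fun x => Derive (a (S j)) x ^ 2)) by (apply ex_RInt_cont; apply Cp).
        assert (E1 := staircase_energy s beta V (M j) S0 (approx_cells_pos j) HV Hs Hs0 Hs1 HsS).
        assert (E2 := staircase_energy s beta V (M (S j)) S0 (approx_cells_pos (S j)) HV Hs Hs0 Hs1 HsS).
        cbv zeta in E1, E2.
        change (RInt (fun x => Derive (a j) x ^ 2) 0 (2 * PI) <= S0 ^ 2 * W ^ 2 / h j) in E1.
        change (RInt (fun x => Derive (a (S j)) x ^ 2) 0 (2 * PI) <= S0 ^ 2 * W ^ 2 / h (S j)) in E2.
        rewrite approx_width_S in E2.
        replace (S0 ^ 2 * W ^ 2 / (h j / 4)) with (4 * (S0 ^ 2 * W ^ 2 / h j)) in E2 by (field; lra).
        change (RInt (fun x => Derive (a j) x ^ 2) 0 (2 * PI)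
                + RInt (fun x => Derive (a (S j)) x ^ 2) 0 (2 * PI) <= 5 * (S0 ^ 2 * W ^ 2 / h j)).
        lra. }
  assert (HQ2 : Q ^ 2 <= d ^ 2 * S0 ^ 2 * (4 * h j ^ 2 * W ^ 2)).
  { apply Rle_trans with ((Rabs d * S0 * (2 * h j * W)) ^ 2); [apply pow_incr; exact HQ|].
    apply Req_le. rewrite <- (pow2_abs d). ring. }
  assert (Hh2 : h j <= 2 * PI).
  { apply Rle_trans with (1 := approx_width_le j).
    assert ((/ 4) ^ j <= 1) by (rewrite <- (pow1 j); apply pow_incr; lra). nra. }
  assert (HAr : 0 <= 8 * A / Rabs r) by (apply Rdiv_le_0_compat; lra).
  assert (Hr2 : 0 <= r ^ 2) by apply pow2_ge_0.
  apply Rle_trans with (8 * r ^ 2 * (d ^ 2 * S0 ^ 2 * (4 * h j ^ 2 * W ^ 2))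
    * (4 * PI * Rabs r + 8 * A / Rabs r * (5 * (S0 ^ 2 * W ^ 2 / h j)))).
  - apply Rmult_le_compat.
    + apply Rmult_le_pos; [lra|apply pow2_ge_0].
    + apply Rplus_le_le_0_compat; [nra|apply Rmult_le_pos; lra].
    + apply Rmult_le_compat_l; lra.
    + apply Rplus_le_compat_l. apply Rmult_le_compat_l; lra.
  - unfold B.
    replace (8 * r ^ 2 * (d ^ 2 * S0 ^ 2 * (4 * h j ^ 2 * W ^ 2))
      * (4 * PI * Rabs r + 8 * A / Rabs r * (5 * (S0 ^ 2 * W ^ 2 / h j))))
      with (d ^ 2 * (32 * r ^ 2 * S0 ^ 2 * W ^ 2
        * (4 * PI * h j * Rabs r + 40 * A * S0 ^ 2 * W ^ 2 / Rabs r)) * h j) by (field; lra).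
    apply Rmult_le_compat_r; [lra|]. apply Rmult_le_compat_l; [apply pow2_ge_0|].
    apply Rmult_le_compat_l.
    + apply Rmult_le_pos; [|apply pow2_ge_0]. apply Rmult_le_pos; [lra|apply pow2_ge_0].
    + apply Rplus_le_compat_r. apply Rmult_le_compat_r; [lra|].
      replace (8 * PI ^ 2) with (4 * PI * (2 * PI)) by ring. apply Rmult_le_compat_l; lra.
Qed.

(** While the time lies in [[j, j + 1]] the energy is at most [d ^ 2 * B * h j], whose root decays
    like [(/ 2) ^ j]. Replacing this by an exponential of the time gives one continuous majorant for
    the whole path. *)
Lemma approx_dist_le (m n : nat) :
  Rbar_le (dist_Bi A (approx_curve m) (approx_curve n))
    (2 * sqrt (2 * PI * B) / ln 2 * ((/ 2) ^ m + (/ 2) ^ n)).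
Proof.
  (* The successor places both end scales strictly below [K], as [al_nat] requires. *)
  pose (K := S (max m n)). pose (b := INR m). pose (d := INR n - INR m).
  pose (c := fun t => angle_curve p r (al K b d t)).
  assert (HK : (0 < K)%nat) by (unfold K; lia).
  assert (Hp := two_PI_pos). assert (HW := variation_pos). assert (Hl := ln_2_pos).
  assert (Hra : 0 < Rabs r) by (apply Rabs_pos_lt, Hr).
  assert (HB : 0 <= B).
  { unfold B. apply Rmult_le_pos.
    - apply Rmult_le_pos; [|apply pow2_ge_0]. apply Rmult_le_pos; [|apply pow2_ge_0].
      apply Rmult_le_pos; [lra|apply pow2_ge_0].
    - apply Rplus_le_le_0_compat.
      + apply Rmult_le_pos; [|lra]. apply Rmult_le_pos; [lra|apply pow2_ge_0].
      + apply Rdiv_le_0_compat; [|exact Hra].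
        apply Rmult_le_pos; [|apply pow2_ge_0]. apply Rmult_le_pos; [lra|apply pow2_ge_0]. }
  assert (Horb : forall e, same_orbit e e).
  { intros e. exists (fun x => x). split; [|reflexivity].
    split; [apply smooth_smooth1, smooth_id|]. split.
    - intros x. rewrite Derive_id. lra.
    - left. reflexivity. }
  (* The root comes from [h j <= 2 * PI * (/ 4) ^ j]; the factor 2 pays for replacing [j] by the
     running time, which may reach [j + 1]. *)
  pose (w := fun t => 2 * sqrt (2 * PI * B) * (Rabs d * exp (- ((b + d * t) * ln 2)))).
  assert (Cw0 : forall t, continuous (fun t => Rabs d * exp (- ((b + d * t) * ln 2))) t).
  { intros t. apply (ex_derive_continuous (fun t => Rabs d * exp (- ((b + d * t) * ln 2)))).
    auto_derive. exact I. }
  assert (Hsq : 0 <= sqrt (2 * PI * B)) by apply sqrt_pos.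
  assert (Hlen : hor_length A c <= RInt w 0 1).
  { apply (hor_length_le p r (al K b d) Hr (al_jointly_smooth K b d)
             (fun t => al_mean K b d t HK)).
    - intros t. apply (@continuous_scal_r R_UniformSpace R_AbsRing R_NormedModule
        (2 * sqrt (2 * PI * B))), Cw0.
    - intros t _. unfold w. apply Rmult_le_pos; [lra|].
      apply Rmult_le_pos; [apply Rabs_pos|left; apply exp_pos].
    - intros t Ht.
      assert (Hbd : 0 <= b + d * t <= INR K).
      { assert (Hm : INR m <= INR K) by (apply le_INR; unfold K; lia).
        assert (Hn : INR n <= INR K) by (apply le_INR; unfold K; lia).
        assert (Hm0 := pos_INR m). assert (Hn0 := pos_INR n). unfold b, d. split; nra. }
      destruct (cell_exists K (b + d * t) HK Hbd) as [j [Hj Hjt]].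
      apply Rle_trans with (1 := angle_energy_le p r (al K b d) Hr (al_jointly_smooth K b d)
             (fun t => al_mean K b d t HK) A t HA).
      apply Rle_trans with (1 := al_energy_le K j b d t Hj Hjt).
      assert (E : (/ 2) ^ j <= 2 * exp (- ((b + d * t) * ln 2))).
      { apply Rle_trans with (2 * exp (- (INR (S j) * ln 2))).
        - rewrite exp_half_pow. simpl. lra.
        - apply Rmult_le_compat_l; [lra|]. apply exp_nondecreasing. rewrite S_INR. nra. }
      apply Rle_trans with ((sqrt (2 * PI * B) * (Rabs d * (/ 2) ^ j)) ^ 2).
      + rewrite !Rpow_mult_distr, pow2_sqrt, pow2_abs by (apply Rmult_le_pos; lra).
        replace (((/ 2) ^ j) ^ 2) with ((/ 4) ^ j).
        2:{ rewrite <- pow_mult, Nat.mul_comm, pow_mult. f_equal. field. }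
        assert (Hw := approx_width_le j).
        replace (2 * PI * B * (d ^ 2 * (/ 4) ^ j)) with (d ^ 2 * B * (2 * PI * (/ 4) ^ j)) by ring.
        apply Rmult_le_compat_l; [|exact Hw]. apply Rmult_le_pos; [apply pow2_ge_0|exact HB].
      + apply pow_incr. split.
        * apply Rmult_le_pos; [exact Hsq|]. apply Rmult_le_pos; [apply Rabs_pos|apply pow_le; lra].
        * unfold w.
          replace (2 * sqrt (2 * PI * B) * (Rabs d * exp (- ((b + d * t) * ln 2))))
            with (sqrt (2 * PI * B) * (Rabs d * (2 * exp (- ((b + d * t) * ln 2))))) by ring.
          apply Rmult_le_compat_l; [exact Hsq|]. apply Rmult_le_compat_l; [apply Rabs_pos|exact E]. }
  apply Rbar_le_trans with (Finite (hor_length A c)).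
  - destruct (Glb_Rbar_correct (fun r => exists c : R -> R -> pt,
      is_path_imm c /\ same_orbit (c 0) (approx_curve m) /\ same_orbit (c 1) (approx_curve n) /\
      r = hor_length A c)) as [Hlb _].
    apply Hlb. exists c. split; [apply al_path_imm, HK|]. split; [|split; [|reflexivity]].
    + unfold c. rewrite (al_nat K m) by (unfold K, b; lia || ring). apply Horb.
    + unfold c. rewrite (al_nat K n) by (unfold K, b, d; lia || ring). apply Horb.
  - simpl. apply Rle_trans with (1 := Hlen). unfold w.
    rewrite (@RInt_scal R_CompleteNormedModule (fun t => Rabs d * exp (- ((b + d * t) * ln 2))))
      by (apply ex_RInt_cont, Cw0).
    change (2 * sqrt (2 * PI * B) * RInt (fun t => Rabs d * exp (- ((b + d * t) * ln 2))) 0 1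
      <= 2 * sqrt (2 * PI * B) / ln 2 * ((/ 2) ^ m + (/ 2) ^ n)).
    assert (E := RInt_exp_decay_le b d).
    replace (b + d) with (INR n) in E by (unfold b, d; ring). unfold b in E at 2.
    rewrite !exp_half_pow in E.
    apply Rle_trans with (2 * sqrt (2 * PI * B) * (((/ 2) ^ m + (/ 2) ^ n) / ln 2)).
    + apply Rmult_le_compat_l; [lra|exact E].
    + apply Req_le. field. lra.
Qed.

End Approximation.

(** * Completion *)

Lemma lipschitz_of_derivative_bound (f df : R -> R) (x y : R) :
  (forall x, is_derive f x (df x)) -> (forall x, Rabs (df x) <= 1) ->
  Rabs (f x - f y) <= Rabs (x - y).
Proof.
  intros Hf Hdf. destruct (MVT_gen f y x df) as [z [_ ->]].
  - intros z _. apply Hf.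
  - intros z _. apply continuity_pt_filterlim, (ex_derive_continuous f z). eexists; apply Hf.
  - rewrite Rabs_mult. assert (H := Hdf z). assert (P := Rabs_pos (x - y)). nra.
Qed.

Lemma Rabs_cos_le (x : R) : Rabs (cos x) <= 1.
Proof. apply Rabs_le, COS_bound. Qed.

Lemma Rabs_sin_le (x : R) : Rabs (sin x) <= 1.
Proof. apply Rabs_le, SIN_bound. Qed.

Lemma cos_lipschitz (x y : R) : Rabs (cos x - cos y) <= Rabs (x - y).
Proof.
  apply (lipschitz_of_derivative_bound cos (fun x => - sin x)); [apply is_derive_cos|].
  intros z. rewrite Rabs_Ropp. apply Rabs_sin_le.
Qed.

Lemma sin_lipschitz (x y : R) : Rabs (sin x - sin y) <= Rabs (x - y).
Proof. apply (lipschitz_of_derivative_bound sin cos); [apply is_derive_sin|apply Rabs_cos_le]. Qed.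

Lemma pnorm_bounds (x y : R) :
  Rabs x <= pnorm (x, y) /\ Rabs y <= pnorm (x, y) /\ pnorm (x, y) <= Rabs x + Rabs y.
Proof.
  unfold pnorm; simpl fst; simpl snd.
  assert (Hx := pow2_ge_0 x). assert (Hy := pow2_ge_0 y).
  assert (Px := Rabs_pos x). assert (Py := Rabs_pos y).
  rewrite <- (pow2_abs x), <- (pow2_abs y) in *.
  split; [|split].
  - rewrite <- (sqrt_pow2 (Rabs x)) at 1 by exact Px. apply sqrt_le_1_alt. lra.
  - rewrite <- (sqrt_pow2 (Rabs y)) at 1 by exact Py. apply sqrt_le_1_alt. lra.
  - rewrite <- (sqrt_pow2 (Rabs x + Rabs y)) by lra. apply sqrt_le_1_alt. nra.
Qed.

(** The identity serves as the reparametrization. [frechet_dist] admits only finite suprema, so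
    finiteness is shown first: [e] bounds from above and the value at 0 from below. *)
Lemma frechet_dist_le (c d : R -> pt) (e : R) :
  (forall x, pdist (c x) (d x) <= e) -> Rbar_le (frechet_dist c d) e.
Proof.
  intros H. unfold frechet_dist.
  assert (Hs : exists l, sup_dist c d = Finite l /\ l <= e).
  { unfold sup_dist.
    destruct (Lub_Rbar_correct (fun r => exists th, r = pdist (c th) (d th))) as [H1 H2].
    set (l := Lub_Rbar _) in *.
    assert (U : Rbar_le l e) by (apply H2; intros u [th ->]; apply H).
    assert (L := H1 _ (ex_intro _ 0 eq_refl)).
    destruct l as [l| |]; [exists l; split; [reflexivity|exact U]|destruct U|destruct L]. }
  destruct Hs as [l [Hl Hle]].
  apply Rbar_le_trans with (Finite l); [|exact Hle].
  destruct (Glb_Rbar_correct (fun r => exists h, is_homeoS1 h /\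
    Finite r = sup_dist (fun th => c (h th)) d)) as [Hlb _].
  apply Hlb. exists (fun x => x). split; [|symmetry; exact Hl].
  split; [|split].
  - intros x. apply derivable_continuous_pt, derivable_pt_id.
  - left. auto.
  - left. reflexivity.
Qed.

Lemma period_representative (x : R) : exists k, 0 <= x + 2 * PI * IZR k <= 2 * PI.
Proof.
  assert (Hp := two_PI_pos). exists (- Int_part (x / (2 * PI)))%Z. rewrite opp_IZR.
  assert (H := Int_part_spec_IZR (x / (2 * PI))).
  set (q := IZR (Int_part (x / (2 * PI)))) in *.
  replace (x + 2 * PI * - q) with (2 * PI * (x / (2 * PI) - q)) by (field; lra).
  split; nra.
Qed.

Lemma half_pow_small (e : R) : 0 < e -> exists n0, forall n, (n0 <= n)%nat -> (/ 2) ^ n < e.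
Proof.
  intros He. destruct (pow_lt_1_zero (/ 2)) with (y := e) as [n0 Hn0]; [|exact He|].
  - rewrite Rabs_right; lra.
  - exists n0. intros n Hn. apply Rle_lt_trans with (2 := Hn0 n Hn), Rle_abs.
Qed.

Theorem theorem3p11 (A : R) (c0 : R -> pt) :
  0 < A ->
  periodic c0 ->
  lipschitz c0 ->
  (exists x y, c0 x <> c0 y) ->
  (exists (L : R) (alpha : R -> R),
     curve_length c0 = Finite L /\
     locally_BV alpha /\
     (forall th, exists k : Z, alpha (th + 2 * PI) - alpha th = 2 * PI * IZR k) /\
     exists N : R -> Prop, negligible N /\
       forall th, ~ N th ->
         is_derive (fun s => fst (c0 s)) th (L / (2 * PI) * cos (alpha th)) /\
         is_derive (fun s => snd (c0 s)) th (L / (2 * PI) * sin (alpha th))) ->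
  exists cn : nat -> R -> pt,
    (forall n, is_imm (cn n)) /\
    (forall eps, 0 < eps -> exists N0 : nat, forall m n, (N0 <= m)%nat -> (N0 <= n)%nat ->
        Rbar_lt (dist_Bi A (cn m) (cn n)) (Finite eps)) /\
    (forall eps, 0 < eps -> exists N0 : nat, forall n, (N0 <= n)%nat ->
        Rbar_lt (frechet_dist (cn n) c0) (Finite eps)).
Proof.
  intros HA Hper [K HK] [x0 [y0 Hne]] [L [alpha [_ [HBV [Hz [N [HN Hd]]]]]]].
  assert (Hp := two_PI_pos).
  pose (f1 := fun x => fst (c0 x)). pose (f2 := fun x => snd (c0 x)).
  assert (L1 : R_lipschitz f1).
  { exists K. intros x y. apply Rle_trans with (2 := HK x y).
    apply (pnorm_bounds (f1 x - f1 y) (f2 x - f2 y)). }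
  assert (L2 : R_lipschitz f2).
  { exists K. intros x y. apply Rle_trans with (2 := HK x y).
    apply (pnorm_bounds (f1 x - f1 y) (f2 x - f2 y)). }
  set (r := L / (2 * PI)) in Hd.
  assert (Hr : r <> 0).
  { intros Hr. rewrite Hr in Hd. apply Hne.
    assert (Z : forall f x y, R_lipschitz f ->
      (forall th, ~ N th -> is_derive f th 0) -> x <= y -> f y = f x).
    { intros f x y Hf Hdf Hxy.
      assert (E := lipschitz_increment_abs f N x y 0 Hxy Hf HN).
      assert (E' : Rabs (f y - f x) <= 0 * (y - x)).
      { apply E. intros th _ Hth. exists 0. split; [apply Hdf, Hth|rewrite Rabs_R0; lra]. }
      apply Rabs_le_between in E'. lra. }
    assert (Z' : forall f x y, R_lipschitz f ->
      (forall th, ~ N th -> is_derive f th 0) -> f x = f y).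
    { intros f x y Hf Hdf. destruct (Rle_dec x y).
      - symmetry; apply Z; auto.
      - apply Z; auto; lra. }
    apply injective_projections; [apply (Z' f1)|apply (Z' f2)]; try assumption; intros th Hth;
      destruct (Hd th Hth) as [D1 D2].
    - rewrite Rmult_0_l in D1. exact D1.
    - rewrite Rmult_0_l in D2. exact D2. }
  (* The integer at the point 0 fixes the turning of the extended angle on all periods. *)
  destruct (Hz 0) as [k Hk]. rewrite Rplus_0_l in Hk.
  pose (beta := extend alpha (alpha (2 * PI) - alpha 0)).
  assert (Hbeta : forall x, beta (x + 2 * PI) = beta x + 2 * PI * IZR k).
  { intros x. rewrite <- Hk. apply extend_period. }
  destruct (locally_BV_variation alpha HBV) as [V HV0].
  assert (HV : variation_bound beta V).
  { intros x y Hx Hxy Hy. unfold beta. rewrite !extend_eq by lra. apply HV0; lra. }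
  assert (D1 : forall x, 0 <= x <= 2 * PI -> ~ N x -> is_derive f1 x (r * cos (beta x))).
  { intros x Hx HNx. unfold beta. rewrite extend_eq by exact Hx. apply Hd, HNx. }
  assert (D2 : forall x, 0 <= x <= 2 * PI -> ~ N x -> is_derive f2 x (r * sin (beta x))).
  { intros x Hx HNx. unfold beta. rewrite extend_eq by exact Hx. apply Hd, HNx. }
  assert (P1 : f1 (2 * PI) = f1 0) by (unfold f1; rewrite <- (Hper 0), Rplus_0_l; reflexivity).
  assert (P2 : f2 (2 * PI) = f2 0) by (unfold f2; rewrite <- (Hper 0), Rplus_0_l; reflexivity).
  destruct smooth_step as [s [S0 [Hs [Hs0 [Hs1 [Hs01 [HsS Hsd]]]]]]].
  assert (HW := variation_bound_mono beta V 0 (2 * PI) HV ltac:(lra) ltac:(lra) ltac:(lra)).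
  set (W := V (2 * PI) - V 0).
  (* With more than [4 * W] cells the mean velocity, at most [Rabs r * W] over the number of cells,
     is at most [Rabs r / 4]. *)
  destruct (INR_unbounded (4 * W)) as [M0 HM0].
  assert (HM0' : (0 < M0)%nat) by (apply INR_lt; simpl; unfold W in HM0; lra).
  assert (Cc : forall x, continuous cos x)
    by (intros x; apply (ex_derive_continuous cos); eexists; apply is_derive_cos).
  assert (Cs : forall x, continuous sin x)
    by (intros x; apply (ex_derive_continuous sin); eexists; apply is_derive_sin).
  assert (HMj : forall j, (0 < M0 * 4 ^ j)%nat) by (intros; apply approx_cells_pos, HM0').
  assert (Hmean : forall j g, (forall x, continuous g x) -> close_at beta V (M0 * 4 ^ j) g ->
    Rabs (mean (fun x => r * cos (g x))) <= Rabs r / 4 /\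
    Rabs (mean (fun x => r * sin (g x))) <= Rabs r / 4).
  { intros j g Hg Hcl.
    assert (HMr : 4 * W <= INR (M0 * 4 ^ j)).
    { rewrite mult_INR, pow_INR.
      assert (1 <= INR 4 ^ j) by (apply pow_R1_Rle; simpl; lra).
      assert (HI := pos_INR M0). nra. }
    assert (HMp := lt_0_INR _ (HMj j)).
    assert (E : Rabs r * (2 * PI / INR (M0 * 4 ^ j)) * W / (2 * PI) <= Rabs r / 4).
    { replace (Rabs r * (2 * PI / INR (M0 * 4 ^ j)) * W / (2 * PI))
        with (Rabs r * (W / INR (M0 * 4 ^ j))) by (field; lra).
      apply Rmult_le_compat_l; [apply Rabs_pos|].
      apply Rmult_le_reg_r with (INR (M0 * 4 ^ j)); [exact HMp|].
      unfold Rdiv. rewrite Rmult_assoc, Rinv_l by lra. lra. }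
    split; apply Rle_trans with (2 := E).
    - apply (close_at_mean f1 cos beta V N r (M0 * 4 ^ j)); auto using cos_lipschitz, Rabs_cos_le.
    - apply (close_at_mean f2 sin beta V N r (M0 * 4 ^ j)); auto using sin_lipschitz, Rabs_sin_le. }
  pose (cn := approx_curve s beta M0 (c0 0) r).
  exists cn. split; [|split].
  - intros n. apply (approx_imm s beta V k M0 (c0 0) r); assumption.
  - intros eps Heps.
    assert (HD := approx_dist_le s beta V k S0 M0 (c0 0) r Hs Hs0 Hs1 Hs01 HsS Hsd Hbeta HV HM0' Hr
                    Hmean A HA).
    match type of HD with forall m n, Rbar_le _ (Finite (?C0 * _)) => set (C := C0) in HD end.
    assert (HC : 0 <= C).
    { apply Rdiv_le_0_compat; [|apply ln_2_pos]. apply Rmult_le_pos; [lra|apply sqrt_pos]. }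
    assert (He : 0 < eps / (2 * (C + 1))) by (apply Rdiv_lt_0_compat; lra).
    destruct (half_pow_small _ He) as [n0 Hn0]. exists n0. intros m n Hm Hn.
    apply Rbar_le_lt_trans with (1 := HD m n). simpl.
    assert (E1 := Hn0 m Hm). assert (E2 := Hn0 n Hn).
    assert (Q1 : 0 < (/ 2) ^ m) by (apply pow_lt; lra).
    assert (Q2 : 0 < (/ 2) ^ n) by (apply pow_lt; lra).
    replace eps with ((C + 1) * (eps / (2 * (C + 1)) + eps / (2 * (C + 1)))) by (field; lra).
    nra.
  - intros eps Heps.
    (* Two coordinates, each off by at most [2 * Rabs r * h * W]; the decay [(/ 4) ^ n] of the width
       is relaxed to [(/ 2) ^ n]. *)
    pose (C := 4 * (Rabs r * (2 * PI) * W)).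
    assert (HC : 0 <= C).
    { unfold C. assert (Hra := Rabs_pos r). assert (0 <= W) by (unfold W; lra).
      apply Rmult_le_pos; [lra|]. apply Rmult_le_pos; [|assumption]. apply Rmult_le_pos; lra. }
    assert (He : 0 < eps / (C + 1)) by (apply Rdiv_lt_0_compat; lra).
    destruct (half_pow_small _ He) as [n0 Hn0]. exists n0. intros n Hn.
    apply Rbar_le_lt_trans with (Finite (C * (/ 2) ^ n)).
    2:{ simpl. assert (E := Hn0 n Hn). assert (Q : 0 < (/ 2) ^ n) by (apply pow_lt; lra).
        replace eps with ((C + 1) * (eps / (C + 1))) by (field; lra). nra. }
    apply frechet_dist_le. intros x.
    assert (Hcn : periodic (cn n)).
    { apply (approx_imm s beta V k M0 (c0 0) r Hs Hs0 Hs1 Hs01 Hbeta HV HM0' Hr Hmean n). }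
    (* The comparison with [c0] holds on [[0, 2 * PI]], and both curves are periodic. *)
    destruct (period_representative x) as [q Hq].
    rewrite <- (periodic_IZR pt (cn n) q x Hcn), <- (periodic_IZR pt c0 q x Hper).
    set (y := x + 2 * PI * IZR q) in *.
    assert (Hcl := approx_close s beta V M0 Hs0 Hs1 Hs01 HV n).
    assert (Hcont : forall x, continuous (approx_angle s beta M0 n) x).
    { intros z. apply smooth_continuous, (approx_smooth s beta M0 Hs Hs0 Hs1 HM0'). }
    assert (E1 : Rabs (fst (cn n y) - f1 y) <= 2 * (Rabs r * (2 * PI / INR (M0 * 4 ^ n)) * W)).
    { apply (close_at_prim f1 cos beta V N r (M0 * 4 ^ n)); auto using cos_lipschitz, Rabs_cos_le. }
    assert (E2 : Rabs (snd (cn n y) - f2 y) <= 2 * (Rabs r * (2 * PI / INR (M0 * 4 ^ n)) * W)).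
    { apply (close_at_prim f2 sin beta V N r (M0 * 4 ^ n)); auto using sin_lipschitz, Rabs_sin_le. }
    unfold pdist.
    destruct (pnorm_bounds (fst (cn n y) - fst (c0 y)) (snd (cn n y) - snd (c0 y))) as [_ [_ B]].
    apply Rle_trans with (1 := B). unfold f1 in E1. unfold f2 in E2.
    assert (Hw := approx_width_le M0 HM0' n).
    assert (Hpow : (/ 4) ^ n <= (/ 2) ^ n) by (apply pow_incr; lra).
    assert (Hh : 2 * PI / INR (M0 * 4 ^ n) <= 2 * PI * (/ 2) ^ n) by nra.
    assert (Rabs r * (2 * PI / INR (M0 * 4 ^ n)) * W <= Rabs r * (2 * PI * (/ 2) ^ n) * W).
    { apply Rmult_le_compat_r; [unfold W; lra|].
      apply Rmult_le_compat_l; [apply Rabs_pos|exact Hh]. }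
    unfold C. lra.
Qed.
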